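(* Let $\mathbb{M},\mathbb{S}\in\mathbb{R}^{2nm\times 2nm}$ be the mass and stiffness matrices, $\mathbf{R}$ the block upper triangular matrix of the block Gram-Schmidt orthogonalization $\mathbf{U}(\mathbf{x})=\mathbf{V}(\mathbf{x})\mathbf{R}$, $\mathfrak{g}_j$ ($j\ge 0$) the Galerkin coefficients, and $\mathbb{D}(t)\in\mathbb{R}^{2m\times 2m}$ the data matrices, all as defined in the context, and suppose that the $2nm$ columns of $\mathbf{U}=(\mathbf{u}_0,\dots,\mathbf{u}_{n-1})$ are linearly independent. Write $\mathbb{M}_{j,l},\mathbb{S}_{j,l}$, $j,l=0,\dots,n-1$, for the $2m\times 2m$ blocks of $\mathbb{M}$ and $\mathbb{S}$. Then: (i) The blocks of $\mathbb{M}$ and $\mathbb{S}$ are determined by the data matrices as follows: for all $j,l=0,\dots,n-1$, $$\mathbb{M}_{j,l}=\tfrac12\left[\mathbb{D}(t_{j+l})+\mathbb{D}(t_{|j-l|})\right],$$ $$\mathbb{S}_{j,l}=\tfrac14\left[\mathbb{D}(t_{j+l+1})+\mathbb{D}(t_{|j-l-1|})+\mathbb{D}(t_{j+l-1})+\mathbb{D}(t_{|j-l+1|})\right].$$ (ii) $\mathbf{R}$ is the block Cholesky square root of the mass matrix (with symmetric positive definite diagonal blocks): $\mathbb{M}=\mathbf{R}^T\mathbf{R}$. (iii) The first $n$ Galerkin coefficients are the $2nm\times 2m$ block columns of the identity matrix $\mathbf{I}_{2nm}$: $\mathfrak{g}_j=\mathbf{i}_j$ for $j=0,\dots,n-1$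.
   Context: **Domain, medium, operator.** $\Omega\subset\mathbb{R}^2$ is a bounded, simply connected domain with Lipschitz boundary and outer unit normal $\mathbf{n}=(n_1,n_2)$; $\mathbf{n}^\perp=(-n_2,n_1)$ and $\nabla^\perp=(-\partial_{x_2},\partial_{x_1})$. The wave speed $\mathbf{c}(\mathbf{x})\in\mathbb{R}^{2\times2}$ is a piecewise smooth, symmetric positive definite matrix field, equal to $c_o I$ (with a constant $c_o>0$) near $\partial\Omega$ and in the vicinity of the antennas (within distance $2c_oT_f$). Define $$A\psi=-\mathbf{c}\,\nabla^\perp\left[\nabla^\perp\cdot(\mathbf{c}\,\psi)\right],$$ with domain the set of $\psi$ such that $\mathbf{c}\psi\in \mathbf{H}_0(\nabla^\perp;\Omega)=\{\psi\in \mathbf{L}^2(\Omega):\nabla^\perp\cdot\psi\in L^2(\Omega),\ \mathbf{n}^\perp\cdot\psi|_{\partial\Omega}=0\}$. $A$ is self-adjoint and positive semidefinite, with closed range and $[\mathrm{range}(A)]^\perp=\mathrm{null}(A)$. Let $\mathbb{A}$ be the restriction of $A$ to the orthogonal complement of $\mathrm{null}(A)$, i.e. to $\mathrm{range}(A)$; it is positive definite with compact resolvent, with eigenvalues $0<\theta_1\le\theta_2\le\cdots\to\infty$ and eigenfunctions $(\varphi_q)_{q\ge1}$ forming an orthonormal basis of $\mathrm{range}(A)$. Functions $\Psi(\mathbb{A})$ are defined spectrally. **Excitations and data.** There are $m$ antennas, modeled by real functions $F^{(s)}\in L^2(\Omega)$, $s=1,\dots,m$, supported near points $\mathbf{x}_s$,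 and a real pulse $f(t)$ supported in $(-T_f,T_f)$ with Fourier transform $\hat f$ satisfying $\hat f(0)=\int f\,dt=0$. $\mathbf{e}_1,\mathbf{e}_2$ is the canonical basis of $\mathbb{R}^2$. For $s=1,\dots,m$, $p=1,2$, let $\mathbb{U}^{(s,p)}(t,\mathbf{x})$ be the solution of $(A+\partial_t^2)\mathbb{U}^{(s,p)}=-c_o^2f'(t)\mathbb{F}^{(s,p)}(\mathbf{x})$, vanishing for $t<-T_f$, where $\mathbb{F}^{(s,p)}$ is the orthogonal projection of $F^{(s)}\mathbf{e}_p$ on $\mathrm{range}(A)$. The measurements are $\mathbb{W}^{(s',p'),(s,p)}(t)=\mathbf{e}_{p'}^T\int_\Omega F^{(s')}(\mathbf{x})\,\mathbb{U}^{(s,p)}(t,\mathbf{x})\,d\mathbf{x}$, and the $2m\times2m$ data matrix is $$\mathbb{D}(t)=-c_o^{-2}\left[f(-t)\star_t\mathbb{W}(t)+f(t)\star_t\mathbb{W}(-t)\right],$$ where $\star_t$ is convolution in $t$. Equivalently, its entries are $$\mathbb{D}^{(s',p'),(s,p)}(t)=\int_\Omega [\mathbf{u}_0^{(s',p')}(\mathbf{x})]^T\mathbf{u}^{(s,p)}(t,\mathbf{x})\,d\mathbf{x},\qquad t\in\mathbb{R},$$ where $$\mathbf{u}_0^{(s,p)}=\sum_{q\ge1}|\hat f(\sqrt{\theta_q})|\left[\mathbf{e}_p^T\int_\Omega F^{(s)}(\mathbf{x}')\varphi_q(\mathbf{x}')\,d\mathbf{x}'\right]\varphi_q,\qquad \mathbf{u}^{(s,p)}(t,\cdot)=\cos(t\sqrt{\mathbb{A}})\,\mathbf{u}_0^{(s,p)}.$$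 **Snapshots.** Fix $\tau>0$, $n\geq 1$ and $t_j=j\tau$. The snapshot $\mathbf{u}_j(\mathbf{x})\in\mathbb{R}^{2\times 2m}$ has columns $\mathbf{u}^{(1,1)}(t_j,\mathbf{x}),\mathbf{u}^{(1,2)}(t_j,\mathbf{x}),\dots,\mathbf{u}^{(m,1)}(t_j,\mathbf{x}),\mathbf{u}^{(m,2)}(t_j,\mathbf{x})$, so $\mathbf{u}_j=\cos(j\tau\sqrt{\mathbb{A}})\mathbf{u}_0$ (operators act columnwise). The snapshots satisfy $\mathbf{u}_{j+1}=2\mathcal{P}\mathbf{u}_j-\mathbf{u}_{|j-1|}$, $j\ge0$, with $\mathcal{P}=\cos(\tau\sqrt{\mathbb{A}})$. Set $\mathbf{U}(\mathbf{x})=(\mathbf{u}_0(\mathbf{x}),\dots,\mathbf{u}_{n-1}(\mathbf{x}))\in\mathbb{R}^{2\times 2nm}$. It is assumed throughout that the span of the columns of $\mathbf{U}$ has dimension $2nm$. **Matrices.** The mass and stiffness matrices are $$\mathbb{M}=\int_\Omega \mathbf{U}^T(\mathbf{x})\mathbf{U}(\mathbf{x})\,d\mathbf{x},\qquad \mathbb{S}=\int_\Omega \mathbf{U}^T(\mathbf{x})\,\mathcal{P}\mathbf{U}(\mathbf{x})\,d\mathbf{x}.$$ The block Gram-Schmidt orthogonalization is $\mathbf{U}(\mathbf{x})=\mathbf{V}(\mathbf{x})\mathbf{R}$, where $\mathbf{V}=(\mathbf{v}_0,\dots,\mathbf{v}_{n-1})$ has $2\times2m$ components with $\int_\Omega\mathbf{v}_j^T\mathbf{v}_k\,d\mathbf{x}=\mathbf{I}_{2m}\delta_{jk}$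 and $\mathbf{v}_j\in\mathrm{span}\{\mathbf{u}_0,\dots,\mathbf{u}_j\}$, and $\mathbf{R}\in\mathbb{R}^{2nm\times2nm}$ is block upper triangular with $2m\times2m$ blocks and, to fix uniqueness, symmetric positive definite diagonal blocks. **Galerkin coefficients.** $\mathbf{i}_j$ denotes the $(j+1)$-th $2nm\times2m$ block column of the identity $\mathbf{I}_{2nm}$. The Galerkin approximation of the snapshots is $\mathbf{u}_j^{\rm Gal}(\mathbf{x})=\mathbf{U}(\mathbf{x})\mathfrak{g}_j$, $j\ge0$, with coefficients $\mathfrak{g}_j\in\mathbb{R}^{2nm\times2m}$ determined by $\mathfrak{g}_0=\mathbf{i}_0$ and orthogonality of the residual of the time stepping scheme to the span of $\mathbf{U}$: $$\mathbf{0}=\int_\Omega\mathbf{V}^T(\mathbf{x})\left[\mathbf{U}(\mathbf{x})(\mathfrak{g}_{j+1}+\mathfrak{g}_{|j-1|})-2\mathcal{P}\mathbf{U}(\mathbf{x})\mathfrak{g}_j\right]d\mathbf{x}=\mathbf{R}^{-T}\left[\mathbb{M}(\mathfrak{g}_{j+1}+\mathfrak{g}_{|j-1|})-2\mathbb{S}\,\mathfrak{g}_j\right],\quad j\ge0.$$ *)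

(* Defs.v *)
(* MathComp / MathComp-Analysis. *)
From HB Require Import structures.
From mathcomp Require Import all_boot all_order all_algebra.
From mathcomp Require Import all_classical all_reals all_analysis.
Set Implicit Arguments.
Unset Strict Implicit.
Unset Printing Implicit Defensive.
Import Order.TTheory GRing.Theory Num.Theory.
Import numFieldNormedType.Exports.
Local Open Scope classical_set_scope.
Local Open Scope ring_scope.

(* Points of the plane are pairs; vector and matrix fields take values in
   'cV[R]_2 and 'M[R]_2.  Index 0 of 'I_2 is the x_1 component, index 1 the
   x_2 component. *)
Notation plane R := (R * R)%type.
Notation vfield R := (plane R -> 'cV[R]_2).

Notation area R := (@lebesgue_measure R \x @lebesgue_measure R)%E.

(* Euclidean distance: the norm provided by the library on R * R is the
   maximum norm, which only serves for the topology. *)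
Definition eucl_dist (R : realType) (x y : plane R) : R :=
  Num.sqrt ((x.1 - y.1) ^+ 2 + (x.2 - y.2) ^+ 2).

(** Geometry of the domain *)

Definition boundary (R : realType) (Om : set (plane R)) : set (plane R) :=
  closure Om `\` interior Om.

Definition simply_connected (R : realType) (Om : set (plane R)) : Prop :=
  connected Om /\
  forall gam : R -> plane R,
    {within `[0, 1], continuous gam} ->
    gam @` `[0, 1] `<=` Om -> gam 0 = gam 1 ->
    exists (H : R * R -> plane R) (p : plane R),
      [/\ {within `[0, 1] `*` `[0, 1], continuous H},
          H @` (`[0, 1] `*` `[0, 1]) `<=` Om,
          forall t : R, t \in `[0, 1] -> H (0, t) = gam t,
          forall t : R, t \in `[0, 1] -> H (1, t) = p
        & forall r : R, r \in `[0, 1] -> H (r, 0) = H (r, 1)].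

(* Near each boundary point, in suitable orthonormal coordinates with axes
   (nu2, - nu1) and (nu1, nu2), Om lies strictly below a Lipschitz graph. *)
Definition lipschitz_boundary (R : realType) (Om : set (plane R)) : Prop :=
  forall x, boundary Om x ->
    exists (nu1 nu2 r L : R) (g : R -> R),
      [/\ nu1 ^+ 2 + nu2 ^+ 2 = 1, 0 < r, L.-lipschitz g &
          forall y, eucl_dist y x < r ->
            (Om y <-> (y.1 - x.1) * nu1 + (y.2 - x.2) * nu2
                      < g ((y.1 - x.1) * nu2 - (y.2 - x.2) * nu1))].

Definition admissible_domain (R : realType) (Om : set (plane R)) : Prop :=
  [/\ open Om, Om !=set0, bounded_set Om, simply_connected Om
    & lipschitz_boundary Om].

(** Smooth functions and the wave speed *)

Definition unit_dir (R : realType) (i : 'I_2) : plane R :=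
  if i == 0 then (1, 0) else (0, 1).

Definition partial (R : realType) (i : 'I_2) (f : plane R -> R) : plane R -> R :=
  fun x => 'D_(unit_dir R i) f x.

Definition iter_partial (R : realType) (s : seq 'I_2) (f : plane R -> R) :
  plane R -> R := foldr (@partial R) f s.

Definition smooth (R : realType) (f : plane R -> R) : Prop :=
  forall s : seq 'I_2,
    continuous (iter_partial s f) /\
    forall (i : 'I_2) (x : plane R), derivable (iter_partial s f) x (unit_dir R i).

Definition test_function (R : realType) (Om : set (plane R)) (f : plane R -> R) :
  Prop :=
  smooth f /\
  exists K : set (plane R),
    [/\ compact K, K `<=` Om & forall x, ~ K x -> f x = 0].

Definition spd (R : realType) (k : nat) (M : 'M[R]_k) : Prop :=
  M^T = M /\ forall a : 'cV[R]_k, a != 0 -> 0 < (a^T *m M *m a) 0 0.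

(* Up to a null set, Om is a finite disjoint union of open pieces on each of
   which c is the restriction of a smooth field that is still symmetric positive
   definite on the closure of the piece: c may jump across interfaces, but it
   and its inverse stay bounded. *)
Definition piecewise_smooth_spd (R : realType) (Om : set (plane R))
    (c : plane R -> 'M[R]_2) : Prop :=
  [/\ forall i j, measurable_fun Om (fun x => c x i j),
      forall x, Om x -> spd (c x) &
      exists (N : nat) (P : 'I_N -> set (plane R))
             (ce : 'I_N -> plane R -> 'M[R]_2),
        [/\ forall a, open (P a) /\ P a `<=` Om,
            forall a b, a != b -> P a `&` P b = set0,
            {ae (area R), forall x, Om x -> exists a, P a x},
            forall a x, P a x -> c x = ce a x &
            forall a, (forall i j, smooth (fun x => ce a x i j)) /\
                      (forall x, closure (P a) x -> spd (ce a x))]].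

(** Square integrable fields *)

Definition L2 (R : realType) (Om : set (plane R)) (f : plane R -> R) : Prop :=
  measurable_fun Om f /\
  (area R).-integrable Om (EFin \o (fun x => f x ^+ 2)).

Definition L2v (R : realType) (Om : set (plane R)) (v : vfield R) : Prop :=
  forall i, L2 Om (fun x => v x i 0).

Definition inner (R : realType) (Om : set (plane R)) (v w : vfield R) : R :=
  \int[area R]_(x in Om) ((v x)^T *m w x) 0 0.

(* Entrywise integral of a matrix valued function. *)
Definition mxint (R : realType) (Om : set (plane R)) (a b : nat)
    (G : plane R -> 'M[R]_(a, b)) : 'M[R]_(a, b) :=
  \matrix_(i, j) \int[area R]_(x in Om) G x i j.

Definition ae_eq_on (R : realType) (Om : set (plane R)) (a b : nat)
    (G H : plane R -> 'M[R]_(a, b)) : Prop :=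
  {ae (area R), forall x, Om x -> G x = H x}.

(* w = \sum_q a_q phi_q with convergence in L^2. *)
Definition L2_sum (R : realType) (Om : set (plane R)) (a : nat -> R)
    (phi : nat -> vfield R) (w : vfield R) : Prop :=
  L2v Om w /\
  (fun N => let r := fun x => w x - \sum_(q < N) a q *: phi q x in inner Om r r)
    @ \oo --> (0 : R).

(** The operator A *)

Definition grad_perp (R : realType) (f : plane R -> R) : vfield R :=
  fun x => \col_i (if i == 0 then - partial 1 f x else partial 0 f x).

(* g is the weak derivative nabla^perp . v. *)
Definition weak_div_perp (R : realType) (Om : set (plane R)) (v : vfield R)
    (g : plane R -> R) : Prop :=
  forall eta, test_function Om eta ->
    inner Om v (grad_perp eta) = - \int[area R]_(x in Om) (g x * eta x).

(* h is the weak derivative nabla^perp g. *)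
Definition weak_grad_perp (R : realType) (Om : set (plane R)) (g : plane R -> R)
    (h : vfield R) : Prop :=
  forall eta, test_function Om eta -> forall i : 'I_2,
    \int[area R]_(x in Om) (g x * grad_perp eta x i 0)
    = - \int[area R]_(x in Om) (h x i 0 * eta x).

(* v belongs to H_0(nabla^perp; Om) and nabla^perp . v = g.  The tangential trace
   n^perp . v of such a field is the functional on traces of H^1(Om) defined by
   Green's formula
     < n^perp . v, chi > = \int v . nabla^perp chi + \int (nabla^perp . v) chi. *)
Definition H0_div_perp (R : realType) (Om : set (plane R)) (v : vfield R)
    (g : plane R -> R) : Prop :=
  [/\ L2v Om v, L2 Om g, weak_div_perp Om v g &
      forall (chi : plane R -> R) (h : vfield R),
        L2 Om chi -> L2v Om h -> weak_grad_perp Om chi h ->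
        inner Om v h + \int[area R]_(x in Om) (g x * chi x) = 0].

(* Graph of A: psi is in the domain of A and A psi = w. *)
Definition opA (R : realType) (Om : set (plane R)) (c : plane R -> 'M[R]_2)
    (psi w : vfield R) : Prop :=
  [/\ L2v Om psi, L2v Om w &
      exists (g : plane R -> R) (h : vfield R),
        [/\ H0_div_perp Om (fun x => c x *m psi x) g,
            L2v Om h, weak_grad_perp Om g h &
            ae_eq_on Om w (fun x => - (c x *m h x))]].

Definition rangeA (R : realType) (Om : set (plane R)) (c : plane R -> 'M[R]_2)
    (w : vfield R) : Prop := exists psi, opA Om c psi w.

(* Eigenvalues and eigenfunctions of the restriction of A to its (closed)
   range; the last clause is the completeness of (phi_q) in range(A). *)
Definition eigensystem (R : realType) (Om : set (plane R))
    (c : plane R -> 'M[R]_2) (theta : nat -> R) (phi : nat -> vfield R) : Prop :=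
  [/\ 0 < theta 0%N /\ {homo theta : q r / (q <= r)%N >-> q <= r},
      theta @ \oo --> +oo,
      forall q, opA Om c (phi q) (fun x => theta q *: phi q x),
      forall q r, inner Om (phi q) (phi r) = (q == r)%:R &
      forall v, rangeA Om c v <-> L2_sum Om (fun q => inner Om (phi q) v) phi v].

(* T is the operator Psi(A) on range(A) (for bounded Psi), defined spectrally. *)
Definition spectral_op (R : realType) (Om : set (plane R))
    (c : plane R -> 'M[R]_2) (theta : nat -> R) (phi : nat -> vfield R)
    (Psi : R -> R) (T : vfield R -> vfield R) : Prop :=
  forall v, rangeA Om c v ->
    L2_sum Om (fun q => Psi (theta q) * inner Om (phi q) v) phi (T v).

Definition range_projection (R : realType) (Om : set (plane R))
    (c : plane R -> 'M[R]_2) (v pv : vfield R) : Prop :=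
  rangeA Om c pv /\
  forall w, rangeA Om c w -> inner Om (fun x => v x - pv x) w = 0.

(** Excitations, wave field and data *)

Definition pulse (R : realType) (Tf : R) (f : R -> R) : Prop :=
  [/\ 0 < Tf, forall t, derivable f t 1, forall t, Tf <= `|t| -> f t = 0 &
      \int[@lebesgue_measure R]_t f t = 0].

(* |\hat f (omega)|; since f is real this does not depend on the sign convention
   of the Fourier transform. *)
Definition abs_fhat (R : realType) (f : R -> R) (omega : R) : R :=
  Num.sqrt ((\int[@lebesgue_measure R]_t (f t * cos (omega * t))) ^+ 2 +
            (\int[@lebesgue_measure R]_t (f t * sin (omega * t))) ^+ 2).

(* The antennas are at xs s; F s is supported in a disk around xs s. *)
Definition antennas (R : realType) (Om : set (plane R)) (m : nat)
    (xs : 'I_m -> plane R) (F : 'I_m -> plane R -> R) : Prop :=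
  forall s, [/\ Om (xs s), L2 Om (F s) &
    exists2 r : R, 0 < r & forall x, Om x -> r <= eucl_dist x (xs s) -> F s x = 0].

Definition homogeneous_nearby (R : realType) (Om : set (plane R)) (co Tf : R)
    (m : nat) (xs : 'I_m -> plane R) (c : plane R -> 'M[R]_2) : Prop :=
  (exists2 d : R, 0 < d & forall x y, Om x -> boundary Om y ->
     eucl_dist x y < d -> c x = co%:M) /\
  (forall s x, Om x -> eucl_dist x (xs s) <= 2 * co * Tf -> c x = co%:M).

Definition polarized (R : realType) (F : plane R -> R) (p : 'I_2) : vfield R :=
  fun x => F x *: delta_mx p 0.

(* du is the time derivative of u as an L^2(Om)-valued function. *)
Definition L2_time_derivative (R : realType) (Om : set (plane R))
    (u du : R -> vfield R) : Prop :=
  forall t, [/\ L2v Om (u t), L2v Om (du t) &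
    (fun d : R =>
       let r := fun x => d^-1 *: (u (t + d) x - u t x) - du t x in inner Om r r)
      @ (0 : R)^' --> (0 : R)].

Definition wave_solution (R : realType) (Om : set (plane R))
    (c : plane R -> 'M[R]_2) (co Tf : R) (f : R -> R) (FF : vfield R)
    (U : R -> vfield R) : Prop :=
  (exists AU dU ddU : R -> vfield R,
    [/\ forall t, opA Om c (U t) (AU t),
        L2_time_derivative Om U dU,
        L2_time_derivative Om dU ddU &
        forall t, ae_eq_on Om (fun x => AU t x + ddU t x)
                              (fun x => - (co ^+ 2 * derive1 f t) *: FF x)]) /\
  (forall t : R, t < - Tf -> ae_eq_on Om (U t) (fun=> 0)).

(* The 2m excitations are listed as (1,1), (1,2), (2,1), (2,2), ..., that is, in
   the lexicographic order of pairs (antenna, polarization). *)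
Definition exc (m : nat) (k : 'I_(m * 2)) : 'I_m * 'I_2 :=
  enum_val (cast_ord (esym (mxvec_cast m 2)) k).

Definition measurements (R : realType) (Om : set (plane R)) (m : nat)
    (F : 'I_m -> plane R -> R) (U : 'I_m -> 'I_2 -> R -> vfield R) (t : R) :
  'M[R]_(m * 2) :=
  \matrix_(k, l) \int[area R]_(x in Om)
    (F (exc k).1 x * U (exc l).1 (exc l).2 t x (exc k).2 0).

Definition convolution (R : realType) (g h : R -> R) (t : R) : R :=
  \int[@lebesgue_measure R]_s (g s * h (t - s)).

Definition data (R : realType) (Om : set (plane R)) (co : R) (f : R -> R)
    (m : nat) (F : 'I_m -> plane R -> R) (U : 'I_m -> 'I_2 -> R -> vfield R)
    (t : R) : 'M[R]_(m * 2) :=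
  \matrix_(k, l) (- co ^- 2 *
    (convolution (fun s => f (- s)) (fun s => measurements Om F U s k l) t +
     convolution f (fun s => measurements Om F U (- s) k l) t)).

Definition initial_state (R : realType) (Om : set (plane R)) (f : R -> R)
    (theta : nat -> R) (phi : nat -> vfield R) (F : plane R -> R) (p : 'I_2)
    (u0 : vfield R) : Prop :=
  L2_sum Om
    (fun q => abs_fhat f (Num.sqrt (theta q)) *
              \int[area R]_(x in Om) (F x * phi q x p 0))
    phi u0.

(** Snapshots and block matrices *)

(* Total size 2nm, presented as a sum of n block sizes so that the library's
   block matrices (submxblock, submxrow, mxrow) apply. *)
Definition bsize (n m : nat) : nat := \sum_(j < n) (m * 2)%N.

Definition block (R : realType) (n m : nat) (M : 'M[R]_(bsize n m)) (j l : 'I_n) :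
  'M[R]_(m * 2) :=
  @submxblock R n n (fun=> (m * 2)%N) (fun=> (m * 2)%N) M j l.

Definition block_col (R : realType) (a n m : nat) (M : 'M[R]_(a, bsize n m))
    (j : 'I_n) : 'M[R]_(a, m * 2) :=
  @submxrow R n (fun=> (m * 2)%N) a M j.

Definition block_row (R : realType) (a n m : nat) (M : 'M[R]_(bsize n m, a))
    (j : 'I_n) : 'M[R]_(m * 2, a) :=
  @submxcol R n (fun=> (m * 2)%N) a M j.

(* i_j: the block columns of the identity. *)
Definition id_col (R : realType) (n m : nat) (j : 'I_n) :
  'M[R]_(bsize n m, m * 2) := block_col 1%:M j.

(* cosA t stands for cos(t sqrt(A)), so that u^{(s,p)}(t, .) is
   cosA t (u0 s p). *)
Definition snapshot (R : realType) (m : nat) (cosA : R -> vfield R -> vfield R)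
    (u0 : 'I_m -> 'I_2 -> vfield R) (tau : R) (j : nat) :
  plane R -> 'M[R]_(2, m * 2) :=
  fun x => \matrix_(i, k)
    cosA (j%:R * tau) (u0 (exc k).1 (exc k).2) x i 0.

Definition snapshots (R : realType) (n m : nat) (cosA : R -> vfield R -> vfield R)
    (u0 : 'I_m -> 'I_2 -> vfield R) (tau : R) : plane R -> 'M[R]_(2, bsize n m) :=
  fun x => \mxrow_(j < n) snapshot cosA u0 tau j x.

Definition columnwise (R : realType) (T : vfield R -> vfield R) (k : nat)
    (G : plane R -> 'M[R]_(2, k)) : plane R -> 'M[R]_(2, k) :=
  fun x => \matrix_(i, l) T (fun y => col l (G y)) x i 0.

Definition independent_columns (R : realType) (Om : set (plane R)) (k : nat)
    (G : plane R -> 'M[R]_(2, k)) : Prop :=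
  forall a : 'cV[R]_k, ae_eq_on Om (fun x => G x *m a) (fun=> 0) -> a = 0.

Definition mass (R : realType) (Om : set (plane R)) (k : nat)
    (U : plane R -> 'M[R]_(2, k)) : 'M[R]_k :=
  mxint Om (fun x => (U x)^T *m U x).

Definition stiffness (R : realType) (Om : set (plane R)) (k : nat)
    (P : vfield R -> vfield R) (U : plane R -> 'M[R]_(2, k)) : 'M[R]_k :=
  mxint Om (fun x => (U x)^T *m columnwise P U x).

Definition block_upper_triangular (R : realType) (n m : nat)
    (M : 'M[R]_(bsize n m)) : Prop :=
  forall j l : 'I_n, (l < j)%N -> block M j l = 0.

Definition spd_diagonal_blocks (R : realType) (n m : nat)
    (M : 'M[R]_(bsize n m)) : Prop :=
  forall j : 'I_n, spd (block M j j).

Definition block_gram_schmidt (R : realType) (Om : set (plane R)) (n m : nat)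
    (U V : plane R -> 'M[R]_(2, bsize n m)) (Rm : 'M[R]_(bsize n m)) : Prop :=
  [/\ forall k, L2v Om (fun x => col k (V x)),
      ae_eq_on Om U (fun x => V x *m Rm),
      forall j l : 'I_n,
        mxint Om (fun x => (block_col (V x) j)^T *m block_col (V x) l)
        = if j == l then 1%:M else 0,
      forall j : 'I_n, exists C : 'M[R]_(bsize n m, m * 2),
        (forall l : 'I_n, (j < l)%N -> block_row C l = 0) /\
        ae_eq_on Om (fun x => block_col (V x) j) (fun x => U x *m C) &
      block_upper_triangular Rm /\ spd_diagonal_blocks Rm].

Definition block_cholesky (R : realType) (n m : nat)
    (M Rm : 'M[R]_(bsize n m)) : Prop :=
  [/\ block_upper_triangular Rm, spd_diagonal_blocks Rm & M = Rm^T *m Rm].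

(* The absolute value in g `|j - 1| is the one of the integers, so that the
   first step involves g 1 twice. *)
Definition galerkin_coefficients (R : realType) (Om : set (plane R)) (n m : nat)
    (P : vfield R -> vfield R) (U V : plane R -> 'M[R]_(2, bsize n m))
    (g : nat -> 'M[R]_(bsize n m, m * 2)) : Prop :=
  (forall j : 'I_n, val j = 0%N -> g 0%N = id_col R m j) /\
  (forall j : nat,
     mxint Om (fun x => (V x)^T *m
       (U x *m (g j.+1 + g `|(j%:Z - 1)%R|%N) - 2 *: (columnwise P U x *m g j)))
     = 0).

(* Main.v *)
Require Import Defs.
From HB Require Import structures.
From mathcomp Require Import all_boot all_order all_algebra.
From mathcomp Require Import all_classical all_reals all_analysis.
From mathcomp Require Import measurable_realfun ring lra.
Import Order.TTheory GRing.Theory Num.Theory.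
Import numFieldNormedType.Exports.
Local Open Scope classical_set_scope.
Local Open Scope ring_scope.

(** Write w_q for the square roots of the eigenvalues and, for the excitation k,
    a_k(q) = |f^(w_q)| <F_k, phi_q>, the coefficients of the initial state.  The
    formulas for the mass and stiffness matrices rest on one series for the data,
      D_kl(t) = sum_q a_k(q) a_l(q) cos(w_q t).                             (1)

    Why (1) holds.  A is symmetric, because <A psi, psi'> is the integral of the
    product of the two divergences nabla^perp . (c psi), by Green's formula
    (opA_inner).  Hence <phi_q, U> solves a scalar oscillator equation of
    frequency w_q, forced by the derivative of the pulse and starting from rest
    (wave_mode), and the component of U orthogonal to range(A) stays zero
    (wave_orthogonal), so that a receiver sees only the modes (wave_measured).
    For a single oscillator, Duhamel's formula writes the response as a causal
    convolution of cos(w .) with the pulse.  Correlating it with the pulse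
    forwards and backwards in time adds the two causal halves and leaves
    |f^(w)|^2 cos(w t) (oscillator_correlation).  The responses of the modes are
    bounded by their amplitudes, uniformly in time and frequency
    (oscillator_bound); with Bessel's inequality this justifies the termwise
    correlation by dominated convergence (received_correlation).

    From (1) to the matrices.  The snapshots have coefficients
    cos(t_j w_q) a_k(q), so by Parseval's identity the entries of the mass and
    stiffness matrices are series of products of two or three cosines, and the
    product-to-sum formulas turn them into combinations of values of (1)
    (inner_cosA, inner_cosA_cosA).  Since V has orthonormal columns, U = V R
    gives M = R^T R (mass_cholesky).  Finally the exact snapshots obey the very
    recursion that the Galerkin scheme imposes after projection, and R is
    injective by the independence of the columns of U; so, as long as the exact
    snapshots are themselves columns of U, induction identifies the coefficients
    with the columns of the identity (galerkin_id_col). *)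

Set Implicit Arguments.
Unset Strict Implicit.
Unset Printing Implicit Defensive.

(** * Square integrable fields *)

(** The measurable sets of the plane are generated by rectangles; an open set is
    the union of the countably many rational ones that it contains. *)
Lemma open_plane_measurable (R : realType) (Om : set (plane R)) :
  open Om -> measurable Om.
Proof.
move=> oOm.
pose B (q : rat * rat * (rat * rat)) : set (plane R) :=
  `](ratr q.1.1 : R), ratr q.1.2[ `*` `](ratr q.2.1 : R), ratr q.2.2[.
have -> : Om = \bigcup_(q in [set q | B q `<=` Om]) B q.
  apply/seteqP; split => [[x y] Oxy|z [q /= qO qz]]; last exact: qO.
  have /nbhs_ballP[e /= e0 eO] : nbhs (x, y) Om by apply: open_nbhs_nbhs.
  have inter (a b : R) : a < b -> exists q : rat, a < ratr q < b.
    by move=> ab; have [q] := rat_in_itvoo ab; rewrite in_itv/=; exists q.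
  have [q1 q1P] := inter (x - e) x ltac:(lra).
  have [q2 q2P] := inter x (x + e) ltac:(lra).
  have [q3 q3P] := inter (y - e) y ltac:(lra).
  have [q4 q4P] := inter y (y + e) ltac:(lra).
  exists ((q1, q2), (q3, q4)) => /=; last first.
    by split; rewrite /= in_itv/=; apply/andP; split; lra.
  move=> [u v] [/=]; rewrite !in_itv/= => /andP[u1 u2] /andP[v1 v2].
  apply: eO; split; rewrite /= /ball/= ltr_norml; apply/andP; split; lra.
rewrite bigcup_mkcond; apply: countable_bigcupT_measurable => [|q].
  exact: countableP.
case: ifPn => // _; exact: measurableX.
Qed.

Section L2.
Context (R : realType) (Om : set (plane R)) (mOm : measurable Om).
Implicit Types (f g : plane R -> R) (u v w : vfield R).
Local Notation mu := (area R).

Lemma L2_mul_integrable f g : L2 Om f -> L2 Om g ->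
  mu.-integrable Om (EFin \o (fun x => f x * g x)).
Proof.
move=> [mf if2] [mg ig2].
apply: (@le_integrable _ _ _ mu Om mOm _
  ((EFin \o (fun x => f x ^+ 2)%R) \+ (EFin \o (fun x => g x ^+ 2)%R))%E).
- by apply/measurable_EFinP; exact: measurable_funM.
- move=> x _ /=; rewrite lee_fin normrM.
  have := sqr_ge0 (`|f x| - `|g x|); rewrite sqrrB !real_normK ?num_real// => h.
  have hf := sqr_ge0 (f x); have hg := sqr_ge0 (g x).
  have h0 : 0 <= `|f x| * `|g x| by exact: mulr_ge0.
  rewrite [X in _ <= X]ger0_norm ?addr_ge0//; lra.
- exact: integrableD.
Qed.

Lemma L2_lin (a : R) f g : L2 Om f -> L2 Om g -> L2 Om (fun x => a * f x + g x).
Proof.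
move=> Lf Lg; have [[mf if2] [mg ig2]] := (Lf, Lg); split.
  by apply: measurable_funD => //; apply: measurable_funM.
have -> : EFin \o (fun x => (a * f x + g x) ^+ 2) =
    (((fun x => (a ^+ 2)%R%:E * (f x ^+ 2)%R%:E) \+
      (fun x => (2 * a)%R%:E * (f x * g x)%R%:E)) \+
      (EFin \o (fun x => g x ^+ 2)%R))%E.
  by apply/funext => x /=; rewrite -!EFinM -!EFinD; congr EFin; ring.
apply: integrableD => //; apply: integrableD => //; apply: integrableZl => //.
exact: L2_mul_integrable.
Qed.

Lemma L2_zero : L2 Om (fun=> 0).
Proof.
split; first exact: measurable_cst.
rewrite (_ : _ \o _ = cst 0%E); first exact: integrable0.
by apply/funext => x /=; rewrite expr0n.
Qed.

Lemma L2v_lin (a : R) v w : L2v Om v -> L2v Om w ->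
  L2v Om (fun x => a *: v x + w x).
Proof.
move=> Lv Lw i; rewrite (_ : (fun x => _) = fun x => a * v x i 0 + w x i 0).
  exact: L2_lin.
by apply/funext => x; rewrite !mxE.
Qed.

Lemma L2v_zero : L2v Om (fun=> 0).
Proof.
move=> i; rewrite (_ : (fun x => _) = fun=> 0); first exact: L2_zero.
by apply/funext => x; rewrite mxE.
Qed.

Lemma L2v_scale (a : R) v : L2v Om v -> L2v Om (fun x => a *: v x).
Proof.
move=> Lv; rewrite (_ : (fun x => _) = fun x => a *: v x + 0).
  exact: L2v_lin L2v_zero.
by apply/funext => x; rewrite addr0.
Qed.

Lemma L2v_add v w : L2v Om v -> L2v Om w -> L2v Om (fun x => v x + w x).
Proof.
move=> Lv Lw; rewrite (_ : (fun x => _) = fun x => 1 *: v x + w x).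
  exact: L2v_lin.
by apply/funext => x; rewrite scale1r.
Qed.

Lemma L2v_sub v w : L2v Om v -> L2v Om w -> L2v Om (fun x => v x - w x).
Proof.
move=> Lv Lw; rewrite (_ : (fun x => _) = fun x => (-1) *: w x + v x).
  exact: L2v_lin.
by apply/funext => x; rewrite scaleN1r addrC.
Qed.

Lemma L2v_sum n (a : 'I_n -> R) (h : 'I_n -> vfield R) :
  (forall i, L2v Om (h i)) -> L2v Om (fun x => \sum_(i < n) a i *: h i x).
Proof.
elim: n a h => [a h _|n IH a h Lh].
  rewrite (_ : (fun x => _) = fun=> 0); first exact: L2v_zero.
  by apply/funext => x; rewrite big_ord0.
rewrite (_ : (fun x => _) = fun x => a ord0 *: h ord0 x +
   \sum_(i < n) a (lift ord0 i) *: h (lift ord0 i) x).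
  by apply: L2v_lin => //; apply: IH.
by apply/funext => x; rewrite big_ord_recl.
Qed.

Lemma dotE (a b : 'cV[R]_2) :
  (a^T *m b) 0 0 = a 0 0 * b 0 0 + a 1 0 * b 1 0.
Proof.
rewrite mxE big_ord_recl big_ord1 !mxE.
by rewrite (_ : lift ord0 ord0 = 1) //; exact/val_inj.
Qed.

Lemma dot_integrable v w : L2v Om v -> L2v Om w ->
  mu.-integrable Om (EFin \o (fun x => ((v x)^T *m w x) 0 0)).
Proof.
move=> Lv Lw; rewrite (_ : _ \o _ =
  ((EFin \o (fun x => v x 0 0 * w x 0 0)%R)
   \+ (EFin \o (fun x => v x 1 0 * w x 1 0)%R))%E).
  by apply: integrableD => //; exact: L2_mul_integrable.
by apply/funext => x /=; rewrite dotE EFinD.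
Qed.

Lemma innerC v w : inner Om v w = inner Om w v.
Proof.
by apply: eq_Rintegral => x _; rewrite !dotE [v x 0 0 * _]mulrC [v x 1 0 * _]mulrC.
Qed.

Lemma inner_linr (a : R) u v w : L2v Om u -> L2v Om v -> L2v Om w ->
  inner Om u (fun x => a *: v x + w x) = a * inner Om u v + inner Om u w.
Proof.
move=> Lu Lv Lw; rewrite /inner -RintegralZl//; last exact: dot_integrable.
rewrite -RintegralD//; last exact: dot_integrable; last first.
  rewrite (_ : _ \o _ = (fun x => a%:E * (((u x)^T *m v x) 0 0)%:E)%E).
    by apply: integrableZl => //; exact: dot_integrable.
  by apply/funext => x /=; rewrite EFinM.
by apply: eq_Rintegral => x _; rewrite mulmxDr -scalemxAr !mxE.
Qed.

Lemma inner_linl (a : R) u v w : L2v Om u -> L2v Om v -> L2v Om w ->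
  inner Om (fun x => a *: v x + w x) u = a * inner Om v u + inner Om w u.
Proof. by move=> *; rewrite innerC inner_linr// !(innerC u). Qed.

Lemma inner0r u : inner Om u (fun=> 0) = 0.
Proof.
rewrite /inner (_ : (fun x => _) = fun=> 0); first by rewrite Rintegral_cst ?mul0r.
by apply/funext => x; rewrite mulmx0 mxE.
Qed.

Lemma innerZr (a : R) u v : L2v Om u -> L2v Om v ->
  inner Om u (fun x => a *: v x) = a * inner Om u v.
Proof.
move=> Lu Lv; have := inner_linr a Lu Lv L2v_zero.
rewrite inner0r addr0 => <-; congr inner.
by apply/funext => x; rewrite addr0.
Qed.

Lemma innerZl (a : R) u v : L2v Om u -> L2v Om v ->
  inner Om (fun x => a *: v x) u = a * inner Om v u.
Proof. by move=> *; rewrite innerC innerZr// (innerC u). Qed.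

Lemma innerDr u v w : L2v Om u -> L2v Om v -> L2v Om w ->
  inner Om u (fun x => v x + w x) = inner Om u v + inner Om u w.
Proof.
move=> Lu Lv Lw; have := inner_linr 1 Lu Lv Lw.
rewrite mul1r => <-; congr inner; apply/funext => x; by rewrite scale1r.
Qed.

Lemma innerBr u v w : L2v Om u -> L2v Om v -> L2v Om w ->
  inner Om u (fun x => v x - w x) = inner Om u v - inner Om u w.
Proof.
move=> Lu Lv Lw; have := inner_linr (-1) Lu Lw Lv.
rewrite mulN1r addrC => <-; congr inner.
by apply/funext => x; rewrite scaleN1r addrC.
Qed.

Lemma innerBl u v w : L2v Om u -> L2v Om v -> L2v Om w ->
  inner Om (fun x => v x - w x) u = inner Om v u - inner Om w u.
Proof. by move=> *; rewrite innerC innerBr// !(innerC u). Qed.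

Lemma inner_sumr n u (a : 'I_n -> R) (h : 'I_n -> vfield R) :
  L2v Om u -> (forall i, L2v Om (h i)) ->
  inner Om u (fun x => \sum_(i < n) a i *: h i x) =
  \sum_(i < n) a i * inner Om u (h i).
Proof.
move=> Lu; elim: n a h => [a h _|n IH a h Lh].
  rewrite big_ord0 (_ : (fun x => _) = fun=> 0) ?inner0r//.
  by apply/funext => x; rewrite big_ord0.
rewrite big_ord_recl -IH// -inner_linr//; last exact: L2v_sum.
by congr inner; apply/funext => x; rewrite big_ord_recl.
Qed.

Lemma inner_ge0 v : 0 <= inner Om v v.
Proof.
by apply: Rintegral_ge0 => x _; rewrite dotE -!expr2 addr_ge0 ?sqr_ge0.
Qed.

(** Null fields are not identified with zero, so the case <w, w> = 0 needs its own
    argument. *)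
Lemma inner_cauchy_schwarz v w : L2v Om v -> L2v Om w ->
  inner Om v w ^+ 2 <= inner Om v v * inner Om w w.
Proof.
move=> Lv Lw.
have quad (a b : R) :
    0 <= a ^+ 2 * inner Om v v + 2 * a * b * inner Om v w + b ^+ 2 * inner Om w w.
  have Lz : L2v Om (fun x => a *: v x + b *: w x).
    by apply: L2v_lin => //; exact: L2v_scale.
  have := inner_ge0 (fun x => a *: v x + b *: w x).
  rewrite inner_linr//; last exact: L2v_scale.
  rewrite innerZr// !inner_linl ?innerZl//; try exact: L2v_scale.
  rewrite (innerC w v) => h; apply: le_trans h _.
  by rewrite le_eqVlt; apply/orP; left; apply/eqP; ring.
have v0 := inner_ge0 v; have w0 := inner_ge0 w.
set A := inner Om v v in quad v0 *; set B := inner Om v w in quad *.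
set C := inner Om w w in quad w0 *.
have [C0|Cn0] := eqVneq C 0.
  (* with C = 0 the quadratic is affine in b, which forces B = 0 *)
  have := quad 1 (- (A + 1) / 2 / B); rewrite C0 !mulr0 addr0.
  have [->|Bn0] := eqVneq B 0; first by rewrite expr0n.
  have -> : 1 ^+ 2 * A + 2 * 1 * (- (A + 1) / 2 / B) * B = - 1 by field.
  by rewrite ler0N1.
have Cp : 0 < C by rewrite lt_def Cn0.
have := quad C (- B).
have -> : C ^+ 2 * A + 2 * C * - B * B + (- B) ^+ 2 * C = C * (A * C - B ^+ 2).
  by ring.
by rewrite pmulr_rge0// subr_ge0.
Qed.

(** Stated for the integrands, so that a matrix factor can move from one field to
    the other without separate integrability of the product. *)
Lemma inner_eq_ae u v u' v' :
  L2v Om u -> L2v Om v -> L2v Om u' -> L2v Om v' ->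
  {ae mu, forall x, Om x ->
     ((u x)^T *m v x) 0 0 = ((u' x)^T *m v' x) 0 0} ->
  inner Om u v = inner Om u' v'.
Proof.
move=> Lu Lv Lu' Lv' uv; congr fine; apply: ae_eq_integral => //.
- by have /measurable_int := dot_integrable Lu Lv.
- by have /measurable_int := dot_integrable Lu' Lv'.
- apply: filterS uv; first exact: (ae_filter_ringOfSetsType mu).
  by move=> x /= h Ox; rewrite h.
Qed.

Lemma inner_eq_ae_on u v w : L2v Om u -> L2v Om v -> L2v Om w ->
  ae_eq_on Om v w -> inner Om u v = inner Om u w.
Proof.
move=> Lu Lv Lw vw; apply: inner_eq_ae => //.
apply: filterS vw; first exact: (ae_filter_ringOfSetsType mu).
by move=> x /= h Ox; rewrite h.
Qed.

(** By Cauchy-Schwarz.  Limits in mean square, of series as well as of difference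
    quotients, enter the argument only in this weak form; hence the arbitrary
    filter. *)
Lemma inner_cvg0 (T : Type) (G : set_system T) {FG : Filter G}
    (r : T -> vfield R) v : L2v Om v -> (forall t, L2v Om (r t)) ->
  inner Om (r t) (r t) @[t --> G] --> (0 : R) ->
  inner Om v (r t) @[t --> G] --> (0 : R).
Proof.
move=> Lv Lr r0.
have h : Num.sqrt (inner Om v v * inner Om (r t) (r t)) @[t --> G] --> (0 : R).
  rewrite -(sqrtr0 R) -(mulr0 (inner Om v v)).
  by apply: continuous_cvg; [exact: sqrt_continuous|exact: cvgMr].
apply/norm_cvg0P; apply: (squeeze_cvgr _ (cvg_cst 0) h).
apply: nearW => t; rewrite normr_ge0/= -[X in X <= _]ger0_norm// -sqrtr_sqr.
by rewrite ler_wsqrtr// real_normK ?num_real// inner_cauchy_schwarz.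
Qed.

End L2.

(** * Calculus on the line and the driven oscillator *)

Section Calculus.
Context (R : realType).
Implicit Types (f g h p q : R -> R) (x a b : R).
Local Notation mu := (@lebesgue_measure R).

Lemma is_derive_continuous f f' :
  (forall x, is_derive x (1 : R) f (f' x)) -> continuous f.
Proof.
move=> df x; apply: differentiable_continuous; apply/derivable1_diffP.
by have [] := df x.
Qed.

Lemma is_derive_add f g x a b : is_derive x (1 : R) f a -> is_derive x (1 : R) g b ->
  is_derive x (1 : R) (fun y => f y + g y) (a + b).
Proof. by move=> df dg; exact: (is_deriveD df dg). Qed.

Lemma is_derive_sub f g x a b : is_derive x (1 : R) f a -> is_derive x (1 : R) g b ->
  is_derive x (1 : R) (fun y => f y - g y) (a - b).
Proof. by move=> df dg; exact: (is_deriveB df dg). Qed.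

Lemma is_derive_mul f g x a b : is_derive x (1 : R) f a -> is_derive x (1 : R) g b ->
  is_derive x (1 : R) (fun y => f y * g y) (a * g x + f x * b).
Proof.
move=> df dg; have h := is_deriveM df dg.
by apply: (is_derive_eq h); rewrite /GRing.scale/= addrC mulrC.
Qed.

Lemma is_derive_scale (k : R) f x a : is_derive x (1 : R) f a ->
  is_derive x (1 : R) (fun y => k * f y) (k * a).
Proof.
move=> df; have h := is_derive_mul (is_derive_cst k x 1) df.
by apply: (is_derive_eq h); rewrite mul0r add0r.
Qed.

Lemma is_derive_affine (k t : R) f x a : is_derive (k * x + t) (1 : R) f a ->
  is_derive x (1 : R) (fun y => f (k * y + t)) (k * a).
Proof.
move=> df; rewrite mulrC.
have dl : is_derive x (1 : R) (fun y => k * y + t) k.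
  have h := is_derive_add (is_derive_scale k (is_derive_id x (1 : R)))
    (is_derive_cst t x 1).
  by apply: (is_derive_eq h); rewrite mulr1 addr0.
exact: (@is_derive1_comp _ f (fun y => k * y + t) x a k).
Qed.

Lemma is_derive_near_unique f g x a b : (\forall y \near x, g y = f y) ->
  is_derive x (1 : R) f a -> is_derive x (1 : R) g b -> a = b.
Proof. by move=> /near_eq_is_derive gf [_ <-] /gf [_ <-]. Qed.

Lemma continuous_support_integrable (L : R) h : continuous h ->
  (forall x, L <= `|x| -> h x = 0) -> mu.-integrable setT (EFin \o h).
Proof.
move=> ch h0.
have /integrable_mkcond : mu.-integrable `[- L, L] (EFin \o h).
  apply: continuous_compact_integrable; first exact: segment_compact.
  exact: continuous_subspaceT.
move=> /(_ (measurable_itv _)); rewrite (_ : _ \_ _ = EFin \o h)//.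
apply/funext => x; rewrite patchE; case: ifPn => // /negP xL.
rewrite /= h0// leNgt; apply/negP => xL'; apply: xL.
by rewrite inE/= in_itv/= -ler_norml ltW.
Qed.

(** The integral over the line of a compactly supported continuous function is
    read off a primitive, so identities between such integrals reduce to
    comparing derivatives.  The bound is used for integrands that depend on a
    frequency. *)
Lemma compact_support_primitive (L : R) h : continuous h ->
  (forall x, L <= `|x| -> h x = 0) ->
  exists H : R -> R, [/\ forall x, is_derive x (1 : R) H (h x),
    forall x, x <= - L -> H x = 0,
    forall x, L <= x -> H x = \int[mu]_y h y &
    forall x, `|H x| <= \int[mu]_y `|h y|].
Proof.
move=> ch h0; have ih := continuous_support_integrable ch h0.
exists (fun x => \int[mu]_(y in `]-oo, x]) h y); split => [x|x xL|x xL|x].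
- have [||//|dH Hh] := @continuous_FTC1 R h -oo%O x (x + 1) _ _ _ (ch x).
  + by rewrite ltrDl.
  + exact: integrableS ih.
  + exact: ltNyr.
  + by apply: DeriveDef; [exact: dH|rewrite -derive1E].
- rewrite (@eq_Rintegral _ _ _ _ _ (fun=> 0)).
    by rewrite Rintegral_cst ?mul0r.
  move=> y; rewrite inE/= in_itv/= => yx; apply: h0.
  by rewrite ler_normr; apply/orP; right; rewrite lerNr (le_trans yx).
- rewrite Rintegral_mkcond; congr (Rintegral _ _ _).
  apply/funext => y; rewrite patchE; case: ifPn => // /negP yx.
  rewrite h0// ler_normr; apply/orP; left; apply: (le_trans xL).
  by rewrite leNgt; apply/negP => yx'; apply: yx; rewrite inE/= in_itv/= ltW.
- have ihx : mu.-integrable `]-oo, x] (EFin \o h) by exact: integrableS ih.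
  apply: (le_trans (le_normr_Rintegral _ ihx)); first exact: measurable_itv.
  rewrite Rintegral_mkcond; apply: le_Rintegral => //.
  + have : mu.-integrable `]-oo, x] (EFin \o (Num.norm \o h)).
      exact: integrable_norm.
    by move=> /integrable_mkcond -/(_ (measurable_itv _)); rewrite restrict_EFin.
  + exact: integrable_norm.
  + by move=> y _; rewrite patchE; case: ifPn => _ /=; rewrite ?lexx ?normr_ge0.
Qed.

(** The sum of a primitive of x |-> h (- x) and of the reflection of a primitive of
    h is constant. *)
Lemma integral_reflect (L : R) h : continuous h ->
  (forall x, L <= `|x| -> h x = 0) ->
  \int[mu]_x h (- x) = \int[mu]_x h x.
Proof.
move=> ch h0.
have [H [dH HL HR _]] := compact_support_primitive ch h0.
have ch' : continuous (fun x => h (- x)).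
  by move=> x; apply: (@continuous_comp _ _ _ (@GRing.opp R) h);
    [exact: opp_continuous|exact: ch].
have h0' x : L <= `|x| -> h (- x) = 0 by move=> ?; apply: h0; rewrite normrN.
have [G [dG GL GR _]] := compact_support_primitive ch' h0'.
pose M := `|L|; have ML : L <= M := ler_norm L.
have d0 x : is_derive x (1 : R) (fun y => G y + H (-1 * y + 0)) 0.
  apply: (is_derive_eq (is_derive_add (dG x) (is_derive_affine (dH _)))).
  by rewrite addr0 !mulN1r subrr.
have := is_derive_0_is_cst M (- M) d0.
rewrite !addr0 !mulN1r opprK (HL (- M)) ?lerN2// (GL (- M)) ?lerN2//.
by rewrite GR// HR// addr0 add0r.
Qed.

(** Integration by parts for p(s) q(s + t), whose increment over the line is the
    product of the two final values; the second integral is written after the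
    shift s -> s - t. *)
Lemma cross_correlation (T P Q t : R) p q p' q' :
  continuous p' -> continuous q' ->
  (forall s, T <= `|s| -> p' s = 0) -> (forall s, T <= `|s| -> q' s = 0) ->
  (forall s, is_derive s (1 : R) p (p' s)) ->
  (forall s, is_derive s (1 : R) q (q' s)) ->
  (forall s, s <= - T -> p s = 0) -> (forall s, s <= - T -> q s = 0) ->
  (forall s, T <= s -> p s = P) -> (forall s, T <= s -> q s = Q) ->
  \int[mu]_s (p' s * q (s + t)) + \int[mu]_s (q' s * p (s - t)) = P * Q.
Proof.
move=> cp' cq' p'0 q'0 dp dq pL qL pR qR.
have shift_cont g r : continuous g -> continuous (fun s => g (s + r)).
  move=> cg s; apply: (@continuous_comp _ _ _ (fun s => s + r) g); last exact: cg.
  by apply: cvgD; [exact: cvg_id|exact: cvg_cst].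
have cp := is_derive_continuous dp; have cq := is_derive_continuous dq.
have ch1 : continuous (fun s => p' s * q (s + t)).
  by move=> s; apply: cvgM; [exact: cp'|exact: shift_cont].
have ch2 : continuous (fun s => q' s * p (s - t)).
  by move=> s; apply: cvgM; [exact: cq'|exact: shift_cont].
have [|H1 [dH1 H1L H1R _]] := @compact_support_primitive T _ ch1.
  by move=> s sT; rewrite p'0 ?mul0r.
have [|H2 [dH2 H2L H2R _]] := @compact_support_primitive T _ ch2.
  by move=> s sT; rewrite q'0 ?mul0r.
pose M := `|T| + `|t|.
have d0 s : is_derive s (1 : R)
    (fun s => p s * q (1 * s + t) - (H1 s + H2 (1 * s + t))) 0.
  apply: (is_derive_eq (is_derive_sub
    (is_derive_mul (dp s) (is_derive_affine (dq _)))
    (is_derive_add (dH1 s) (is_derive_affine (dH2 _))))).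
  by rewrite !mul1r addrK; ring.
have := is_derive_0_is_cst M (- M) d0.
have T1 := ler_norm T; have t1 := ler_norm t; have t2 := ler_norm (- t).
have t0 := normr_ge0 t; rewrite normrN in t2.
rewrite !mul1r (pL (- M)) ?(H1L (- M)) ?(H2L (- M + t)) ?mul0r ?addr0 ?subr0;
  try by rewrite /M; lra.
rewrite (pR M) ?(qR (M + t)) ?(H1R M) ?(H2R (M + t));
  by rewrite /M; lra.
Qed.

Section Pulse.
Variables (T w : R) (f : R -> R).
Hypothesis df : forall t, derivable f t 1.
Hypothesis f0 : forall t, T <= `|t| -> f t = 0.

Let is_derive_f t : is_derive t (1 : R) f (derive1 f t).
Proof. by split => //; rewrite derive1E. Qed.

Let cf : continuous f. Proof. exact: is_derive_continuous is_derive_f. Qed.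

Let is_derive_cosw t : is_derive t (1 : R) (fun s => cos (w * s)) (- w * sin (w * t)).
Proof.
have h := is_derive_affine (is_derive_cos (w * t + 0)).
rewrite (_ : (fun s => _) = fun s => cos (w * s + 0)).
  by apply: (is_derive_eq h); rewrite addr0 mulrN mulNr.
by apply/funext => s; rewrite addr0.
Qed.

Let is_derive_sinw t : is_derive t (1 : R) (fun s => sin (w * s)) (w * cos (w * t)).
Proof.
have h := is_derive_affine (is_derive_sin (w * t + 0)).
rewrite (_ : (fun s => _) = fun s => sin (w * s + 0)).
  by apply: (is_derive_eq h); rewrite addr0.
by apply/funext => s; rewrite addr0.
Qed.

Let fc t := f t * cos (w * t).
Let fs t := f t * sin (w * t).

Let cfc : continuous fc.
Proof.
by move=> t; apply: cvgM; [exact: cf|exact: (is_derive_continuous is_derive_cosw)].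
Qed.

Let cfs : continuous fs.
Proof.
by move=> t; apply: cvgM; [exact: cf|exact: (is_derive_continuous is_derive_sinw)].
Qed.

Let fc0 t : T <= `|t| -> fc t = 0.
Proof. by move=> /f0; rewrite /fc => ->; rewrite mul0r. Qed.
Let fs0 t : T <= `|t| -> fs t = 0.
Proof. by move=> /f0; rewrite /fs => ->; rewrite mul0r. Qed.

(** Duhamel's formula.  C and S are the cosine and sine transforms of the pulse
    truncated at time t, so the right-hand side is the convolution of the pulse with
    the causal part of cos(w .).  The forcing K f' is integrated by parts in
    advance, because f' need not be integrable.  Uniqueness is conservation of the
    oscillator energy. *)
Lemma oscillator_duhamel (K : R) (u du C S : R -> R) : 0 < w ->
  (forall t, is_derive t (1 : R) C (fc t)) ->
  (forall t, is_derive t (1 : R) S (fs t)) ->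
  (forall t, t <= - T -> C t = 0) -> (forall t, t <= - T -> S t = 0) ->
  (forall t, is_derive t (1 : R) u (du t)) ->
  (forall t, is_derive t (1 : R) du (K * derive1 f t - w ^+ 2 * u t)) ->
  (forall t, t < - T -> u t = 0) ->
  forall t, u t = K * (cos (w * t) * C t + sin (w * t) * S t).
Proof.
move=> w0 dC dS CL SL du' ddu u0 t.
pose y s := K * (cos (w * s) * C s + sin (w * s) * S s).
pose dy s := K * (w * (cos (w * s) * S s - sin (w * s) * C s) + f s).
have dyP s : is_derive s (1 : R) y (dy s).
  apply: (is_derive_eq (is_derive_scale K (is_derive_add
    (is_derive_mul (is_derive_cosw s) (dC s))
    (is_derive_mul (is_derive_sinw s) (dS s))))).
  rewrite /dy /fc /fs; have := cos2Dsin2 (w * s).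
  set c := cos _; set z := sin _ => cz; rewrite -[X in _ = K * (_ + X)]mulr1 -cz.
  by ring.
have ddyP s : is_derive s (1 : R) dy (K * derive1 f s - w ^+ 2 * y s).
  apply: (is_derive_eq (is_derive_scale K (is_derive_add (is_derive_scale w
    (is_derive_sub (is_derive_mul (is_derive_cosw s) (dS s))
    (is_derive_mul (is_derive_sinw s) (dC s)))) (is_derive_f s)))).
  by rewrite /y /fc /fs; ring.
pose E s := (du s - dy s) * (du s - dy s) + w ^+ 2 * ((u s - y s) * (u s - y s)).
have dE s : is_derive s (1 : R) E 0.
  have dz := is_derive_sub (du' s) (dyP s).
  have ddz := is_derive_sub (ddu s) (ddyP s).
  apply: (is_derive_eq (is_derive_add (is_derive_mul ddz ddz)
    (is_derive_scale (w ^+ 2) (is_derive_mul dz dz)))).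
  by ring.
have z0 s : s < - T -> u s - y s = 0.
  by move=> sT; rewrite u0// /y CL ?SL ?ltW// !mulr0 addr0 mulr0 subr0.
have E0 : E t = 0.
  rewrite (is_derive_0_is_cst t (- T - 1) dE) /E z0 ?ltrBlDr ?ltrDl//.
  have -> : du (- T - 1) - dy (- T - 1) = 0.
    apply/esym/(is_derive_near_unique (f := fun=> 0) (g := fun s => u s - y s)
      _ (is_derive_cst 0 (- T - 1) 1) (is_derive_sub (du' _) (dyP _))).
    have : \forall s \near - T - 1, s < - T.
      apply: open_nbhs_nbhs; split; first exact: open_lt.
      by rewrite /= ltrBlDr ltrDl.
    by apply: filterS => s /z0.
  by rewrite !mulr0 addr0.
have : w ^+ 2 * (u t - y t) ^+ 2 <= 0.
  by have := sqr_ge0 (du t - dy t); move: E0; rewrite /E !expr2; lra.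
rewrite pmulr_rle0 ?exprn_gt0// => le0; apply/eqP; rewrite -subr_eq0 -sqrf_eq0.
by rewrite eq_le le0 sqr_ge0.
Qed.

(** Correlating the response to a pulse with the same pulse forwards and backwards
    in time symmetrizes the one-sided (causal) response: what is left is the
    energy density of the pulse at the frequency of the oscillator. *)
Lemma oscillator_correlation (K : R) (u du : R -> R) (t : R) : 0 < w ->
  (forall t, is_derive t (1 : R) u (du t)) ->
  (forall t, is_derive t (1 : R) du (K * derive1 f t - w ^+ 2 * u t)) ->
  (forall t, t < - T -> u t = 0) ->
  \int[mu]_s (f (- s) * u (t - s)) + \int[mu]_s (f s * u (- (t - s))) =
  K * (abs_fhat f w ^+ 2 * cos (w * t)).
Proof.
move=> w0 du' ddu u0.
have [C [dC CL CR _]] := compact_support_primitive cfc fc0.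
have [S [dS SL SR _]] := compact_support_primitive cfs fs0.
have uE := oscillator_duhamel w0 dC dS CL SL du' ddu u0.
have cC := is_derive_continuous dC; have cS := is_derive_continuous dS.
have cu := is_derive_continuous du'.
have shift_cont g r : continuous g -> continuous (fun s => g (s + r)).
  move=> cg s; apply: (@continuous_comp _ _ _ (fun s => s + r) g); last exact: cg.
  by apply: cvgD; [exact: cvg_id|exact: cvg_cst].
have prod_int g h r : continuous g -> (forall s, T <= `|s| -> g s = 0) ->
    continuous h -> mu.-integrable setT (EFin \o (fun s => g s * h (s + r))).
  move=> cg g0 ch; apply: (@continuous_support_integrable T) => [s|s sT].
    by apply: cvgM; [exact: cg|exact: shift_cont].
  by rewrite g0 ?mul0r.
pose J r := \int[mu]_s (f s * u (s + r)).
pose cc r := \int[mu]_s (fc s * C (s + r)).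
pose ss r := \int[mu]_s (fs s * S (s + r)).
pose cs r := \int[mu]_s (fc s * S (s + r)).
pose sc r := \int[mu]_s (fs s * C (s + r)).
have JE r : J r = K * (cos (w * r) * (cc r + ss r) + sin (w * r) * (cs r - sc r)).
  have icc := prod_int _ _ r cfc fc0 cC; have iss := prod_int _ _ r cfs fs0 cS.
  have ics := prod_int _ _ r cfc fc0 cS; have isc := prod_int _ _ r cfs fs0 cC.
  have iD g h : mu.-integrable setT (EFin \o g) -> mu.-integrable setT (EFin \o h) ->
      mu.-integrable setT (EFin \o (fun s => g s + h s)).
    by move=> ig ih; exact: (integrableD measurableT ig ih).
  have iB g h : mu.-integrable setT (EFin \o g) -> mu.-integrable setT (EFin \o h) ->
      mu.-integrable setT (EFin \o (fun s => g s - h s)).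
    by move=> ig ih; exact: (integrableB measurableT ig ih).
  have iZ a g : mu.-integrable setT (EFin \o g) ->
      mu.-integrable setT (EFin \o (fun s => a * g s)).
    by move=> ig; exact: (integrableZl measurableT a ig).
  rewrite /cc /ss /cs /sc -RintegralD// -RintegralB//.
  rewrite -!RintegralZl//; try by [apply: (iD)|apply: (iB)].
  rewrite -RintegralD//; try by [apply: (iZ); apply: (iD)|apply: (iZ); apply: (iB)].
  rewrite -RintegralZl//; last by apply: (iD); apply: (iZ); [apply: (iD)|apply: (iB)].
  apply: eq_Rintegral => s _; rewrite uE (mulrDr w) cosD sinD /fc /fs; ring.
have -> : \int[mu]_s (f (- s) * u (t - s)) = J t.
  rewrite /J -[RHS](@integral_reflect T).
  - by apply: eq_Rintegral => s _; rewrite addrC.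
  - by move=> s; apply: cvgM; [exact: cf|exact: shift_cont].
  - by move=> s sT; rewrite f0 ?mul0r.
have -> : \int[mu]_s (f s * u (- (t - s))) = J (- t).
  by apply: eq_Rintegral => s _; rewrite opprB.
(* each correlation at shift t pairs with one at shift - t into a product of the
   full transforms of the pulse; the mixed products cancel *)
have Hcc := cross_correlation t cfc cfc fc0 fc0 dC dC CL CL CR CR.
have Hss := cross_correlation t cfs cfs fs0 fs0 dS dS SL SL SR SR.
have Hcs := cross_correlation t cfc cfs fc0 fs0 dC dS CL SL CR SR.
have Hsc := cross_correlation t cfs cfc fs0 fc0 dS dC SL CL SR CR.
rewrite !JE mulrN cosN sinN /abs_fhat sqr_sqrtr ?addr_ge0 ?sqr_ge0//.
rewrite -/(cc t) -/(cc (- t)) in Hcc; rewrite -/(ss t) -/(ss (- t)) in Hss.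
rewrite -/(cs t) -/(sc (- t)) in Hcs; rewrite -/(sc t) -/(cs (- t)) in Hsc.
rewrite !expr2 -Hcc -Hss.
have -> : cs t = sc t + cs (- t) - sc (- t) by rewrite Hsc mulrC -Hcs addrK.
ring.
Qed.

(** The truncated transforms in Duhamel's formula are at most the integral of |f|.
    The bound is independent of the time and of w, as the domination of a sum over
    all frequencies requires. *)
Lemma oscillator_bound (K : R) (u du : R -> R) (t : R) : 0 < w ->
  (forall t, is_derive t (1 : R) u (du t)) ->
  (forall t, is_derive t (1 : R) du (K * derive1 f t - w ^+ 2 * u t)) ->
  (forall t, t < - T -> u t = 0) ->
  `|u t| <= `|K| * (2 * \int[mu]_s `|f s|).
Proof.
move=> w0 du' ddu u0.
have [C [dC CL CR CB]] := compact_support_primitive cfc fc0.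
have [S [dS SL SR SB]] := compact_support_primitive cfs fs0.
rewrite (oscillator_duhamel w0 dC dS CL SL du' ddu u0) normrM.
have if1 := continuous_support_integrable cf f0.
have ifc := continuous_support_integrable cfc fc0.
have ifs := continuous_support_integrable cfs fs0.
have le1 (a b : R) : `|b| <= 1 -> `|a * b| <= `|a|.
  by move=> b1; rewrite normrM ler_piMr.
have Cf : `|C t| <= \int[mu]_s `|f s|.
  apply: le_trans (CB t) _; apply: le_Rintegral => //; try exact: integrable_norm.
  by move=> s _; apply: le1; rewrite ler_norml cos_geN1 cos_le1.
have Sf : `|S t| <= \int[mu]_s `|f s|.
  apply: le_trans (SB t) _; apply: le_Rintegral => //; try exact: integrable_norm.
  by move=> s _; apply: le1; rewrite ler_norml sin_geN1 sin_le1.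
apply: ler_wpM2l => //; apply: le_trans (ler_normD _ _) _.
rewrite mulr2n mulrDl mul1r; apply: lerD; rewrite mulrC.
  by apply: le_trans Cf; apply: le1; rewrite ler_norml cos_geN1 cos_le1.
by apply: le_trans Sf; apply: le1; rewrite ler_norml sin_geN1 sin_le1.
Qed.

End Pulse.
End Calculus.

(** * Symmetry of the operator and eigenfunction expansions *)

Section Spectral.
Context (R : realType) (Om : set (plane R)) (mOm : measurable Om).
Implicit Types (u v w : vfield R) (a b : nat -> R).

(** Symmetry of the operator.  Green's formula in the definition of
    H_0(nabla^perp) is applied with the divergence of the other field as test
    function. *)
Lemma opA_inner (c : plane R -> 'M[R]_2) psi w psi' w' :
  (forall x, Om x -> (c x)^T = c x) ->
  opA Om c psi w -> opA Om c psi' w' -> inner Om psi' w = inner Om psi w'.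
Proof.
move=> cT.
(* both inner products equal the integral of the product of the two weak
   divergences of the c-weighted fields *)
have form p1 w1 p2 w2 : opA Om c p1 w1 -> opA Om c p2 w2 ->
    forall g1 g2 h1,
      [/\ H0_div_perp Om (fun x => c x *m p2 x) g2, L2 Om g1, L2v Om h1,
          weak_grad_perp Om g1 h1 & ae_eq_on Om w1 (fun x => - (c x *m h1 x))] ->
    inner Om p2 w1 = \int[area R]_(x in Om) (g2 x * g1 x).
  move=> [_ Lw1 _] [Lp2 _ _] g1 g2 h1 [[Lcp _ _ green] Lg1 Lh1 gh1 w1E].
  have -> : \int[area R]_(x in Om) (g2 x * g1 x) =
      - inner Om (fun x => c x *m p2 x) h1.
    by apply/eqP; rewrite -addr_eq0 addrC; apply/eqP; exact: green.
  rewrite -mulN1r -innerZr//; apply: inner_eq_ae => //.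
    exact: L2v_scale.
  apply: filterS w1E; first exact: (ae_filter_ringOfSetsType (area R)).
  move=> x /= w1x Ox; rewrite w1x// trmx_mul cT// mulmxN -scalemxAr scaleN1r.
  by rewrite mulmxA.
move=> A1 A2; have [_ _ [g1 [h1 [H1 Lh1 gh1 w1E]]]] := A1.
have [_ _ [g2 [h2 [H2 Lh2 gh2 w2E]]]] := A2.
have [_ Lg1 _ _] := H1; have [_ Lg2 _ _] := H2.
rewrite (form _ _ _ _ A1 A2 g1 g2 h1)//.
rewrite (form _ _ _ _ A2 A1 g2 g1 h2)//.
by apply: eq_Rintegral => x _; rewrite mulrC.
Qed.

Lemma L2_sum_weak a (phi : nat -> vfield R) u v :
  (forall q, L2v Om (phi q)) -> L2v Om u -> L2_sum Om a phi v ->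
  (fun N => \sum_(q < N) a q * inner Om u (phi q)) @ \oo --> inner Om u v.
Proof.
move=> Lphi Lu [Lv cv].
have LS N : L2v Om (fun x => \sum_(q < N) a q *: phi q x).
  exact: (@L2v_sum _ _ mOm N (fun q => a q) (fun q => phi q)).
have h0 : inner Om u (fun x => v x - \sum_(q < N) a q *: phi q x)
    @[N --> \oo] --> (0 : R).
  by apply: (inner_cvg0 mOm Lu _ cv) => N; exact: L2v_sub.
rewrite -[inner Om u v]subr0.
have : inner Om u v - inner Om u (fun x => v x - \sum_(q < N) a q *: phi q x)
    @[N --> \oo] --> inner Om u v - 0 by apply: cvgB => //; exact: cvg_cst.
apply: cvg_trans; apply: near_eq_cvg; apply: nearW => N /=.
rewrite innerBr//; last exact: LS.
rewrite opprB addrC subrK.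
exact: (@inner_sumr _ _ mOm N u (fun q => a q) (fun q => phi q)).
Qed.

Section Orthonormal.
Variable phi : nat -> vfield R.
Hypothesis Lphi : forall q, L2v Om (phi q).
Hypothesis ortho : forall q r, inner Om (phi q) (phi r) = (q == r)%:R.

Lemma L2_sum_coef a v q : L2_sum Om a phi v -> inner Om (phi q) v = a q.
Proof.
move=> av; have := L2_sum_weak Lphi (Lphi q) av.
move=> /(cvg_lim (@Rhausdorff R)) <-.
apply: (cvg_lim (@Rhausdorff R)); apply: cvg_near_cst; exists q.+1 => // N /= qN.
rewrite (bigD1 (Ordinal qN)) //= ortho eqxx mulr1 big1 ?addr0// => r rq.
rewrite ortho (_ : (q == r) = false) ?mulr0//.
by apply/negbTE; rewrite eq_sym; exact: rq.
Qed.

Lemma L2_sum_parseval a b v w : L2_sum Om a phi v -> L2_sum Om b phi w ->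
  (fun N => \sum_(q < N) a q * b q) @ \oo --> inner Om v w.
Proof.
move=> av bw; rewrite innerC; have [Lw _] := bw.
have := L2_sum_weak Lphi Lw av; apply: cvg_trans; apply: near_eq_cvg.
apply: nearW => N /=; apply: eq_bigr => q _.
by rewrite innerC (L2_sum_coef q bw).
Qed.

Lemma bessel a v N : L2_sum Om a phi v -> \sum_(q < N) a q ^+ 2 <= inner Om v v.
Proof.
move=> av; have cv := L2_sum_parseval av av.
have -> : inner Om v v = limn (fun N => \sum_(q < N) a q * a q).
  by apply/esym; apply: cvg_lim cv.
under eq_bigr do rewrite expr2.
apply: (nondecreasing_cvgn_le (u_ := fun N => \sum_(q < N) a q * a q)).
- apply/nondecreasing_seqP => k; rewrite big_ord_recr/= lerDl -expr2.
  exact: sqr_ge0.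
- by apply/cvg_ex; exists (inner Om v v).
Qed.

End Orthonormal.

(** A mean square derivative is a weak derivative: the equation of a field becomes
    ordinary differential equations for its components. *)
Lemma L2_is_derive (U dU : R -> vfield R) v t : L2v Om v ->
  L2_time_derivative Om U dU ->
  is_derive t (1 : R) (fun s => inner Om v (U s)) (inner Om v (dU t)).
Proof.
move=> Lv dUP; have [LU LdU cv] := dUP t.
have LUs s : L2v Om (U s) by case: (dUP s).
have Lr d : L2v Om (fun x => d^-1 *: (U (t + d) x - U t x) - dU t x).
  by apply: L2v_sub => //; apply: L2v_scale => //; exact: L2v_sub.
have lim : d^-1 *: (inner Om v (U (d *: 1 + t)) - inner Om v (U t))
    @[d --> (0 : R)^'] --> inner Om v (dU t).
  have h0 : inner Om v (fun x => d^-1 *: (U (t + d) x - U t x) - dU t x)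
      @[d --> (0 : R)^'] --> (0 : R).
    exact: (inner_cvg0 mOm Lv Lr cv).
  rewrite -[inner Om v (dU t)]addr0.
  have : inner Om v (dU t)
      + inner Om v (fun x => d^-1 *: (U (t + d) x - U t x) - dU t x)
      @[d --> (0 : R)^'] --> inner Om v (dU t) + 0.
    by apply: cvgD => //; exact: cvg_cst.
  apply: cvg_trans; apply: near_eq_cvg; apply: nearW => d /=.
  have Ld : L2v Om (fun x => U (t + d) x - U t x) by exact: L2v_sub.
  have Lsd : L2v Om (fun x => d^-1 *: (U (t + d) x - U t x)) by exact: L2v_scale.
  rewrite innerBr// innerZr// innerBr//.
  by rewrite addrC subrK (_ : d *: 1 + t = t + d)// addrC /GRing.scale/= mulr1.
apply: DeriveDef; first by apply/cvg_ex; exists (inner Om v (dU t)).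
exact: cvg_lim lim.
Qed.

End Spectral.

(** * Modes of the wave *)

Section Wave.
Context (R : realType) (Om : set (plane R)) (mOm : measurable Om).
Variables (c : plane R -> 'M[R]_2).
Hypothesis cT : forall x, Om x -> (c x)^T = c x.
Variables (theta : nat -> R) (phi : nat -> vfield R).
Hypothesis hphi : eigensystem Om c theta phi.
Implicit Types (u v w : vfield R) (a b : nat -> R).

Lemma eigenvalue_gt0 q : 0 < theta q.
Proof.
have [[t0 mono] _ _ _ _] := hphi.
exact: lt_le_trans t0 (mono _ _ (leq0n q)).
Qed.

Lemma eigenfunction_L2v q : L2v Om (phi q).
Proof. by have [_ _ /(_ q)[Lphi _ _] _ _] := hphi. Qed.

Lemma eigenfunction_ortho q r : inner Om (phi q) (phi r) = (q == r)%:R.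
Proof. by have [_ _ _ /(_ q r) h _] := hphi. Qed.

Lemma L2_sum_rangeA a v : L2_sum Om a phi v -> rangeA Om c v.
Proof.
move=> av; have [_ _ _ _ complete] := hphi; apply/complete.
rewrite (_ : (fun q => _) = a)//; apply/funext => q.
exact: (L2_sum_coef mOm eigenfunction_L2v eigenfunction_ortho q av).
Qed.

Lemma rangeA_L2_sum v : rangeA Om c v ->
  L2_sum Om (fun q => inner Om (phi q) v) phi v.
Proof. by have [_ _ _ _ complete] := hphi; move/complete. Qed.

Lemma rangeA_L2v v : rangeA Om c v -> L2v Om v.
Proof. by case=> psi []. Qed.

(** The completeness clause of an eigensystem characterizes the range by its
    series, and phi_q is its own one-term series. *)
Lemma eigenfunction_rangeA q : rangeA Om c (phi q).
Proof.
apply: (@L2_sum_rangeA (fun r => (r == q)%:R)); split.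
  exact: eigenfunction_L2v.
apply: cvg_near_cst; exists q.+1 => // N /= qN.
rewrite (_ : (fun x => _) = fun=> 0); first exact: inner0r.
apply/funext => x; rewrite (bigD1 (Ordinal qN)) //= eqxx scale1r.
rewrite big1 ?addr0 ?subrr// => r rq.
rewrite (_ : (nat_of_ord r == q) = false) ?scale0r//.
by apply/negbTE; exact: rq.
Qed.

Lemma range_projection_inner v0 pv w : L2v Om v0 ->
  range_projection Om c v0 pv -> rangeA Om c w ->
  inner Om w pv = inner Om w v0.
Proof.
move=> Lv0 [Rpv orth] Rw; have := orth _ Rw.
have Lpv := rangeA_L2v Rpv; have Lw := rangeA_L2v Rw.
by rewrite innerBl// => /eqP; rewrite subr_eq0 !(innerC _ w) => /eqP.
Qed.

Variables (co Tf : R) (f : R -> R) (FF : vfield R) (U : R -> vfield R).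
Hypothesis hU : wave_solution Om c co Tf f FF U.
Hypothesis RFF : rangeA Om c FF.

Let LU t : L2v Om (U t).
Proof. by have [[AU [dU [ddU [_ /(_ t)[LU _ _] _ _]]]] _] := hU. Qed.

Lemma wave_weak v : L2v Om v -> exists (AU : R -> vfield R) (du ddu : R -> R),
  [/\ forall t, opA Om c (U t) (AU t),
      forall t, is_derive t (1 : R) (fun s => inner Om v (U s)) (du t),
      forall t, is_derive t (1 : R) du (ddu t),
      forall t, ddu t =
        - (co ^+ 2 * inner Om v FF) * derive1 f t - inner Om v (AU t) &
      forall t, t < - Tf -> inner Om v (U t) = 0].
Proof.
move=> Lv; have [[AU [dU [ddU [hA hdU hddU eqn]]]] U0] := hU.
exists AU, (fun t => inner Om v (dU t)), (fun t => inner Om v (ddU t)).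
split => [//|t|t|t|t tT].
- exact: L2_is_derive.
- exact: L2_is_derive.
- have [_ LAU _] := hA t; have [_ LddU _] := hddU t.
  have LFF := rangeA_L2v RFF.
  have := inner_eq_ae_on mOm Lv (L2v_add mOm LAU LddU) (L2v_scale mOm _ LFF) (eqn t).
  rewrite innerDr// innerZr// => h.
  have -> : inner Om v (ddU t) = inner Om v (AU t) + inner Om v (ddU t)
    - inner Om v (AU t) by ring.
  by rewrite h; ring.
- rewrite -(inner0r mOm v); apply: inner_eq_ae_on => //; first exact: L2v_zero.
  exact: U0.
Qed.

(** Symmetry of the operator moves it onto the eigenfunction, which decouples the
    modes. *)
Lemma wave_mode q : exists du : R -> R,
  [/\ forall t, is_derive t (1 : R) (fun s => inner Om (phi q) (U s)) (du t),
      forall t, is_derive t (1 : R) du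
        (- (co ^+ 2 * inner Om (phi q) FF) * derive1 f t
         - Num.sqrt (theta q) ^+ 2 * inner Om (phi q) (U t)) &
      forall t, t < - Tf -> inner Om (phi q) (U t) = 0].
Proof.
have [AU [du [ddu [hA hdu hddu eqn u0]]]] := wave_weak (eigenfunction_L2v q).
exists du; split => // t.
apply: (is_derive_eq (hddu t)); rewrite eqn; congr (_ - _).
have [_ _ /(_ q) eig _ _] := hphi.
have Lq := eigenfunction_L2v q.
rewrite (opA_inner mOm cT (hA t) eig) innerC innerZl//.
by rewrite sqr_sqrtr ?ltW ?eigenvalue_gt0.
Qed.

(** The wave has no component orthogonal to the range: there the
    equation is unforced, and the wave starts from rest. *)
Lemma wave_orthogonal v t : L2v Om v ->
  (forall w, rangeA Om c w -> inner Om v w = 0) -> inner Om v (U t) = 0.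
Proof.
move=> Lv orth; have [AU [du [ddu [hA hdu hddu eqn u0]]]] := wave_weak Lv.
have ddu0 s : ddu s = 0.
  rewrite eqn orth// orth; last by exists (U s).
  by rewrite mulr0 oppr0 mul0r addr0.
pose s0 := - Tf - 1.
have near0 : \forall s \near s0, inner Om v (U s) = cst 0 s.
  have : \forall s \near s0, s < - Tf.
    apply: open_nbhs_nbhs; split; first exact: open_lt.
    by rewrite /= ltrBlDr ltrDl.
  by apply: filterS => s /u0.
have du0 s : du s = 0.
  have d0 y : is_derive y (1 : R) du 0 by rewrite -(ddu0 y).
  rewrite (is_derive_0_is_cst s s0 d0).
  exact/esym/(is_derive_near_unique near0 (is_derive_cst 0 s0 1) (hdu s0)).
have d0 y : is_derive y (1 : R) (fun s => inner Om v (U s)) 0.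
  by rewrite -(du0 y).
rewrite (is_derive_0_is_cst t s0 d0).
by rewrite u0// /s0 ltrBlDr ltrDl.
Qed.

(** A receiver sees the wave only through its projection on the range, hence
    through the eigenmodes. *)
Lemma wave_measured v0 pv t : L2v Om v0 -> range_projection Om c v0 pv ->
  (fun N => \sum_(q < N) inner Om (phi q) v0 * inner Om (phi q) (U t)) @ \oo -->
  inner Om v0 (U t).
Proof.
move=> Lv0 hpv; have [Rpv orth] := hpv; have Lpv := rangeA_L2v Rpv.
have -> : inner Om v0 (U t) = inner Om pv (U t).
  apply/eqP; rewrite -subr_eq0 -innerBl//; apply/eqP.
  by apply: wave_orthogonal => //; exact: L2v_sub.
rewrite innerC.
have := L2_sum_weak mOm eigenfunction_L2v (LU t) (rangeA_L2_sum Rpv).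
apply: cvg_trans; apply: near_eq_cvg; apply: nearW => N /=.
apply: eq_bigr => q _; rewrite (innerC _ (U t)).
by rewrite (range_projection_inner Lv0 hpv)//; exact: eigenfunction_rangeA.
Qed.

End Wave.

(** * Series for the data *)

Section Convolution.
Context (R : realType).
Local Notation mu := (@lebesgue_measure R).
Implicit Types g h : R -> R.

Lemma Rintegral_ord_sum N (h : 'I_N -> R -> R) :
  (forall i, mu.-integrable setT (EFin \o h i)) ->
  mu.-integrable setT (EFin \o (fun s => \sum_(i < N) h i s)) /\
  \int[mu]_s (\sum_(i < N) h i s) = \sum_(i < N) \int[mu]_s h i s.
Proof.
elim: N h => [|N IH] h ih.
  rewrite big_ord0 (_ : (fun s => _) = fun=> 0); last first.
    by apply/funext => s; rewrite big_ord0.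
  split; last by rewrite Rintegral_cst// mul0r.
  by rewrite (_ : _ \o _ = cst 0%E)//; exact: integrable0.
have [iS eS] := IH (fun i => h (lift ord0 i)) (fun i => ih _).
rewrite (_ : (fun s => _) =
    fun s => h ord0 s + \sum_(i < N) h (lift ord0 i) s); last first.
  by apply/funext => s; rewrite big_ord_recl.
split; first exact: (integrableD measurableT (ih ord0) iS).
by rewrite RintegralD// eS big_ord_recl.
Qed.

(** Dominated convergence: the uniform bound on the partial sums times the pulse is
    integrable. *)
Lemma correlation_series (T B : R) g (v : nat -> R -> R) (V : R -> R) :
  continuous g -> (forall s, T <= `|s| -> g s = 0) ->
  (forall q, continuous (v q)) ->
  (forall N s, `|\sum_(q < N) v q s| <= B) ->
  (forall s, (fun N => \sum_(q < N) v q s) @ \oo --> V s) ->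
  (fun N => \sum_(q < N) \int[mu]_s (g s * v q s)) @ \oo --> \int[mu]_s (g s * V s).
Proof.
move=> cg g0 cv vB vV.
have cgv q : continuous (fun s => g s * v q s).
  by move=> s; apply: cvgM; [exact: cg|exact: cv].
have igv q : mu.-integrable setT (EFin \o (fun s => g s * v q s)).
  apply: (continuous_support_integrable (L := T)) => // s sT.
  by rewrite g0// mul0r.
have ig := continuous_support_integrable cg g0.
pose S N s := \sum_(q < N) (g s * v q s).
have iS N := Rintegral_ord_sum (fun i : 'I_N => igv i).
have mS N : measurable_fun setT (EFin \o S N) by have [/measurable_int] := iS N.
have SV s : (S N s)%:E @[N --> \oo] --> (g s * V s)%:E.
  apply: cvg_EFin; first exact: nearW.
  rewrite (_ : _ \o _ = fun N => g s * \sum_(q < N) v q s).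
    by apply: cvgMr; exact: vV.
  by apply/funext => N; rewrite /= /S mulr_sumr.
have mV : measurable_fun setT (EFin \o (fun s => g s * V s)).
  by apply: (emeasurable_fun_cvg (fun N => EFin \o S N)) => // s _; exact: SV.
have iBg : mu.-integrable setT (fun s => B%:E * (EFin \o (Num.norm \o g)) s)%E.
  by apply: integrableZl => //; exact: integrable_norm.
have dom : {ae mu, forall s N, setT s ->
    (`|(EFin \o S N) s| <= B%:E * (EFin \o (Num.norm \o g)) s)%E}.
  apply: aeW => s N _; rewrite /= -EFinM lee_fin /S -mulr_sumr normrM mulrC.
  by apply: ler_wpM2r => //; exact: vB.
have aeSV : {ae mu, forall s, setT s -> (EFin \o S N) s @[N --> \oo]
    --> (EFin \o (fun s => g s * V s)) s}.
  by apply: aeW => s _; exact: SV.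
have [iV _ cvgS] := @dominated_convergence _ _ _ mu setT measurableT
  (fun N => EFin \o S N) (EFin \o (fun s => g s * V s)) _ mS mV
  aeSV iBg dom.
have fin := integrable_fin_num measurableT iV.
rewrite -(fineK fin) in cvgS.
have : (fun N => \int[mu]_s S N s) @ \oo --> \int[mu]_s (g s * V s).
  exact: (fine_cvg cvgS).
apply: cvg_trans; apply: near_eq_cvg; apply: nearW => N /=.
by have [_ eS] := iS N; rewrite -eS.
Qed.

End Convolution.

Section Data.
Context (R : realType) (Om : set (plane R)) (mOm : measurable Om).
Variables (c : plane R -> 'M[R]_2).
Hypothesis cT : forall x, Om x -> (c x)^T = c x.
Variables (theta : nat -> R) (phi : nat -> vfield R).
Hypothesis hphi : eigensystem Om c theta phi.
Variables (co Tf : R) (f : R -> R).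
Hypotheses (hco : 0 < co) (hf : pulse Tf f).

Lemma polarized_L2v (F : plane R -> R) p : L2 Om F -> L2v Om (polarized F p).
Proof.
move=> LF i; rewrite (_ : (fun x => _) = fun x => (i == p)%:R * F x + 0).
  exact: (L2_lin mOm _ LF (L2_zero Om)).
by apply/funext => x; rewrite !mxE eqxx andbT addr0 mulrC.
Qed.

Lemma inner_polarized (F : plane R -> R) p w :
  inner Om (polarized F p) w = \int[area R]_(x in Om) (F x * w x p 0).
Proof.
apply: eq_Rintegral => x _.
by rewrite /polarized linearZ/= trmx_delta -scalemxAl -rowE !mxE.
Qed.

(** The series of the data.  The term of index q is the correlation of the pulse
    with one oscillator, of forcing amplitude - co^2 <phi_q, v1> and observed with
    the factor <phi_q, v0>. *)
Lemma received_correlation (v0 v1 F0 F1 : vfield R) (U : R -> vfield R) (t : R) :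
  L2v Om v0 -> L2v Om v1 ->
  range_projection Om c v0 F0 -> range_projection Om c v1 F1 ->
  wave_solution Om c co Tf f F1 U ->
  (fun N => \sum_(q < N)
     abs_fhat f (Num.sqrt (theta q)) * inner Om (phi q) v0 *
     (abs_fhat f (Num.sqrt (theta q)) * inner Om (phi q) v1) *
     cos (Num.sqrt (theta q) * t)) @ \oo -->
  - co ^- 2 * (convolution (fun s => f (- s)) (fun s => inner Om v0 (U s)) t +
               convolution f (fun s => inner Om v0 (U (- s))) t).
Proof.
move=> Lv0 Lv1 pv0 pv1 hU.
have [RF0 _] := pv0; have [RF1 _] := pv1.
have [Tf0 df f0 _] := hf.
pose w q := Num.sqrt (theta q).
have w0 q : 0 < w q by rewrite sqrtr_gt0 (eigenvalue_gt0 hphi).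
pose b0 q := inner Om (phi q) v0; pose b1 q := inner Om (phi q) v1.
have b0E q : inner Om (phi q) F0 = b0 q.
  exact: (range_projection_inner mOm Lv0 pv0 (eigenfunction_rangeA mOm hphi q)).
have b1E q : inner Om (phi q) F1 = b1 q.
  exact: (range_projection_inner mOm Lv1 pv1 (eigenfunction_rangeA mOm hphi q)).
pose u q s := b0 q * inner Om (phi q) (U s).
pose K q := - (co ^+ 2 * (b0 q * b1 q)).
have mode q : exists du : R -> R,
  [/\ forall t, is_derive t (1 : R) (u q) (du t),
      forall t, is_derive t (1 : R) du (K q * derive1 f t - w q ^+ 2 * u q t) &
      forall t, t < - Tf -> u q t = 0].
  have [du [d1 d2 z]] := wave_mode mOm cT hphi hU RF1 q.
  exists (fun s => b0 q * du s); split=> [s|s|s sT].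
  - exact: is_derive_scale.
  - apply: (is_derive_eq (is_derive_scale (b0 q) (d2 s))).
    by rewrite b1E /K /u /w; ring.
  - by rewrite /u z ?mulr0.
have cu q : continuous (u q).
  by have [du [d1 _ _]] := mode q; exact: is_derive_continuous d1.
have cf : continuous f.
  by apply: (@is_derive_continuous _ _ (derive1 f)) => s; split=> //; rewrite derive1E.
pose I := \int[@lebesgue_measure R]_s `|f s|.
have I0 : 0 <= I by apply: Rintegral_ge0.
pose B := co ^+ 2 * (2 * I) * (inner Om F0 F0 + inner Om F1 F1).
have Lphi := eigenfunction_L2v hphi.
have ortho := eigenfunction_ortho hphi.
have uB N s : `|\sum_(q < N) u q s| <= B.
  apply: le_trans (ler_norm_sum _ _ _) _.
  (* |xy| <= x^2 + y^2, then Bessel's inequality for each excitation *)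
  have bess : \sum_(q < N) (b0 q ^+ 2 + b1 q ^+ 2) <= inner Om F0 F0 + inner Om F1 F1.
    rewrite big_split /=; apply: lerD.
    - apply: le_trans (bessel mOm Lphi ortho N (rangeA_L2_sum hphi RF0)).
      by under [leRHS]eq_bigr do rewrite b0E.
    - apply: le_trans (bessel mOm Lphi ortho N (rangeA_L2_sum hphi RF1)).
      by under [leRHS]eq_bigr do rewrite b1E.
  apply: (@le_trans _ _ (\sum_(q < N) co ^+ 2 * (2 * I) * (b0 q ^+ 2 + b1 q ^+ 2))).
    apply: ler_sum => q _; have [du [d1 d2 z]] := mode q.
    apply: le_trans (oscillator_bound df f0 s (w0 q) d1 d2 z) _.
    rewrite -/I /K normrN normrM (ger0_norm (sqr_ge0 co)) -mulrA -mulrA.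
    apply: ler_wpM2l; first exact: sqr_ge0.
    rewrite mulrC; apply: ler_wpM2l; first by rewrite mulr_ge0.
    rewrite ler_norml; have := sqr_ge0 (b0 q + b1 q); have := sqr_ge0 (b0 q - b1 q).
    have := sqr_ge0 (b0 q); have := sqr_ge0 (b1 q).
    by rewrite !expr2 => *; apply/andP; split; nra.
  rewrite -mulr_sumr; apply: ler_wpM2l => //.
  by rewrite mulr_ge0 ?sqr_ge0// mulr_ge0.
have uW s : (fun N => \sum_(q < N) u q s) @ \oo --> inner Om v0 (U s).
  exact: (wave_measured mOm hphi hU RF1 Lv0 pv0).
have comp_cont (h : R -> R) q : continuous h -> continuous (fun s => u q (h s)).
  by move=> ch s; apply: (@continuous_comp _ _ _ h (u q)); [exact: ch|exact: cu].
have cts : continuous (fun s : R => t - s).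
  by move=> s; apply: cvgB; [exact: cvg_cst|exact: cvg_id].
have cv1 := @correlation_series _ Tf B (fun s => f (- s)) (fun q s => u q (t - s))
  (fun s => inner Om v0 (U (t - s))) _ _ _ _ _.
have cv2 := @correlation_series _ Tf B f (fun q s => u q (- (t - s)))
  (fun s => inner Om v0 (U (- (t - s)))) cf f0 _ _ _.
rewrite /convolution.
have lim : - co ^- 2 * (\sum_(q < N) \int[@lebesgue_measure R]_s (f (- s) * u q (t - s))
   + \sum_(q < N) \int[@lebesgue_measure R]_s (f s * u q (- (t - s)))) @[N --> \oo] -->
  - co ^- 2 * (\int[@lebesgue_measure R]_s (f (- s) * inner Om v0 (U (t - s)))
   + \int[@lebesgue_measure R]_s (f s * inner Om v0 (U (- (t - s))))).
  apply: cvgMr; apply: cvgD; [apply: cv1|apply: cv2] => //.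
  - by move=> s; apply: (@continuous_comp _ _ _ (@GRing.opp R) f);
      [exact: opp_continuous|exact: cf].
  - by move=> s sT; apply: f0; rewrite normrN.
  - by move=> q; exact: comp_cont.
  - move=> q; apply: comp_cont => s.
    by apply: cvgN; exact: cts.
apply: cvg_trans lim; apply: near_eq_cvg; apply: nearW => N /=.
rewrite -big_split mulr_sumr; apply: eq_bigr => q _ /=.
have [du [d1 d2 z]] := mode q.
rewrite (oscillator_correlation df f0 t (w0 q) d1 d2 z) /K -/(w q) -/(b0 q) -/(b1 q).
by field; rewrite gt_eqF.
Qed.

(** Formula (1): each entry of the data matrix is one received correlation. *)
Lemma data_series (m : nat) (F : 'I_m -> plane R -> R) (FF : 'I_m -> 'I_2 -> vfield R)
    (UU : 'I_m -> 'I_2 -> R -> vfield R) (t : R) (k l : 'I_(m * 2)) :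
  let v k := polarized (F (exc k).1) (exc k).2 in
  let a k q := abs_fhat f (Num.sqrt (theta q)) * inner Om (phi q) (v k) in
  (forall s, L2 Om (F s)) ->
  (forall s p, range_projection Om c (polarized (F s) p) (FF s p)) ->
  (forall s p, wave_solution Om c co Tf f (FF s p) (UU s p)) ->
  (fun N => \sum_(q < N) a k q * a l q * cos (Num.sqrt (theta q) * t)) @ \oo -->
  data Om co f F UU t k l.
Proof.
move=> v a LF hFF hUU; rewrite mxE.
have measE s : measurements Om F UU s k l = inner Om (v k) (UU (exc l).1 (exc l).2 s).
  by rewrite mxE inner_polarized.
rewrite (_ : (fun s => measurements Om F UU s k l) =
  fun s => inner Om (v k) (UU (exc l).1 (exc l).2 s)); last exact/funext.
rewrite (_ : (fun s => measurements Om F UU (- s) k l) =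
  fun s => inner Om (v k) (UU (exc l).1 (exc l).2 (- s))); last first.
  by apply/funext => s; exact: measE.
by apply: received_correlation (hFF _ _) (hFF _ _) (hUU _ _); exact: polarized_L2v.
Qed.

End Data.

(** * Block Gram-Schmidt orthogonalization and the Galerkin scheme *)

Lemma mxint_trmul (R : realType) (Om : set (plane R)) a b
    (A : plane R -> 'M[R]_(2, a)) (B : plane R -> 'M[R]_(2, b)) i j :
  mxint Om (fun x => (A x)^T *m B x) i j =
  inner Om (fun x => col i (A x)) (fun x => col j (B x)).
Proof.
rewrite mxE; apply: eq_Rintegral => x _.
by rewrite !mxE; apply: eq_bigr => k _; rewrite !mxE.
Qed.

Definition block_index (n m : nat) (j : 'I_n) (k : 'I_(m * 2)) : 'I_(bsize n m) :=
  @tagnat.Rank n (fun=> m * 2)%N j k.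

Lemma block_index_eq n m (j l : 'I_n) (k i : 'I_(m * 2)) :
  (block_index j k == block_index l i) = (j == l) && (k == i).
Proof. by rewrite -val_eqE tagnat.eq_Rank. Qed.

Lemma block_indexP n m (s : 'I_(bsize n m)) : exists j k, s = block_index j k.
Proof.
by exists (tagnat.sig1 s), (tagnat.sig2 s); rewrite /block_index tagnat.sig2K.
Qed.

Lemma col_block_col (R : realType) a n m (M : 'M[R]_(a, bsize n m)) j k :
  col k (block_col M j) = col (block_index j k) M.
Proof. by apply/matrixP => i z; rewrite !mxE. Qed.

Lemma col_id_col (R : realType) n m (j : 'I_n) k :
  col k (id_col R m j) = delta_mx (block_index j k) 0.
Proof.
by rewrite col_block_col; apply/matrixP => i z; rewrite !mxE ord1 eqxx andbT.
Qed.

Section Columns.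
Context (R : realType) (Om : set (plane R)) (mOm : measurable Om).

Lemma mulmx_columns N (A : 'M[R]_(2, N)) (a : 'cV[R]_N) :
  A *m a = \sum_(k < N) a k 0 *: col k A.
Proof.
apply/matrixP => i z; rewrite ord1 mxE summxE; apply: eq_bigr => k _.
by rewrite !mxE mulrC.
Qed.

Lemma L2v_mulmx N (A : plane R -> 'M[R]_(2, N)) (a : 'cV[R]_N) :
  (forall k, L2v Om (fun x => col k (A x))) -> L2v Om (fun x => A x *m a).
Proof.
move=> LA; rewrite (_ : (fun x => _) = fun x => \sum_(k < N) a k 0 *: col k (A x)).
  exact: L2v_sum.
by apply/funext => x; rewrite mulmx_columns.
Qed.

Lemma inner_mulmx N (A : plane R -> 'M[R]_(2, N)) (a : 'cV[R]_N) u :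
  L2v Om u -> (forall k, L2v Om (fun x => col k (A x))) ->
  inner Om u (fun x => A x *m a) =
  \sum_(k < N) a k 0 * inner Om u (fun x => col k (A x)).
Proof.
move=> Lu LA; rewrite -inner_sumr//; congr inner.
by apply/funext => x; rewrite mulmx_columns.
Qed.

Section GramSchmidt.
Variables (n m : nat) (U V : plane R -> 'M[R]_(2, bsize n m)).
Variable (Rm : 'M[R]_(bsize n m)).
Hypothesis LU : forall k, L2v Om (fun x => col k (U x)).
Hypothesis gs : block_gram_schmidt Om U V Rm.

Let LV k : L2v Om (fun x => col k (V x)). Proof. by have [LV _ _ _ _] := gs. Qed.

Lemma gram_schmidt_orthonormal r s :
  inner Om (fun x => col r (V x)) (fun x => col s (V x)) = (r == s)%:R.
Proof.
have [_ _ orth _ _] := gs.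
have [j [k ->]] := block_indexP r; have [l [i ->]] := block_indexP s.
have := congr1 (fun M : 'M[R]_(m * 2) => M k i) (orth j l).
rewrite mxint_trmul.
have colE' p q : (fun x => col q (block_col (V x) p)) =
    fun x => col (block_index p q) (V x).
  by apply/funext => x; exact: col_block_col.
by rewrite !colE' block_index_eq => ->; case: eqP => _; rewrite !mxE.
Qed.

Lemma gram_schmidt_mul (a : 'cV[R]_(bsize n m)) :
  ae_eq_on Om (fun x => U x *m a) (fun x => V x *m (Rm *m a)).
Proof.
have [_ UVR _ _ _] := gs.
apply: filterS UVR; first exact: (ae_filter_ringOfSetsType (area R)).
by move=> x /= h Ox; rewrite h// mulmxA.
Qed.

Lemma gram_schmidt_coef r (a : 'cV[R]_(bsize n m)) :
  inner Om (fun x => col r (V x)) (fun x => U x *m a) = (Rm *m a) r 0.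
Proof.
rewrite (inner_eq_ae_on mOm _ _ _ (gram_schmidt_mul a))//; try exact: L2v_mulmx.
rewrite inner_mulmx// (bigD1 r)//= gram_schmidt_orthonormal eqxx mulr1.
rewrite big1 ?addr0// => s sr; rewrite gram_schmidt_orthonormal eq_sym.
by rewrite (negbTE sr) mulr0.
Qed.

Lemma mass_cholesky : mass Om U = Rm^T *m Rm.
Proof.
apply/matrixP => s t; rewrite mxint_trmul.
have colU r : (fun x => col r (U x)) = fun x => U x *m delta_mx r 0.
  by apply/funext => x; rewrite colE.
rewrite !colU.
rewrite innerC (inner_eq_ae_on mOm _ _ _ (gram_schmidt_mul _))//;
  try exact: L2v_mulmx.
rewrite inner_mulmx//; last exact: L2v_mulmx.
rewrite mxE; apply: eq_bigr => k _; rewrite innerC gram_schmidt_coef.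
by rewrite -!colE !mxE.
Qed.

(** The inner products of U a with the columns of V are the entries of R a.  If
    they vanish, so does U a = V R a, and the columns of U are independent. *)
Lemma gram_schmidt_inj (a : 'cV[R]_(bsize n m)) :
  independent_columns Om U ->
  (forall r, inner Om (fun x => col r (V x)) (fun x => U x *m a) = 0) -> a = 0.
Proof.
move=> ind Va0; apply: ind.
have Ra0 : Rm *m a = 0.
  by apply/matrixP => r z; rewrite ord1 -gram_schmidt_coef Va0 mxE.
have := gram_schmidt_mul a; rewrite Ra0.
by rewrite (_ : (fun x => V x *m 0) = fun=> 0)//; apply/funext => x; rewrite mulmx0.
Qed.

(** Two steps of the scheme are compared with two steps of the recursion for the
    exact fields y.  In the first step the unknown occurs twice, because
    |0 - 1| = 1. *)
Lemma galerkin_id_col (P : vfield R -> vfield R)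
    (y : nat -> 'I_(m * 2) -> vfield R) (g : nat -> 'M[R]_(bsize n m, m * 2)) :
  (forall (j : 'I_n) k, (fun x => col (block_index j k) (U x)) = y j k) ->
  (forall i k, L2v Om (P (y i k))) ->
  (forall u i k, L2v Om u ->
     inner Om u (y i.+1 k) + inner Om u (y `|(i%:Z - 1)%R|%N k) =
     2 * inner Om u (P (y i k))) ->
  independent_columns Om U -> galerkin_coefficients Om P U V g ->
  forall j : 'I_n, g j = id_col R m j.
Proof.
move=> colU LP rec ind [g0 gal].
have colPU (j : 'I_n) k :
    (fun x => col (block_index j k) (columnwise P U x)) = P (y j k).
  by apply/funext => x; apply/matrixP => i z; rewrite ord1 -colU !mxE.
have colGP x r (G : plane R -> 'M[R]_(2, bsize n m)) :
  G x *m delta_mx r 0 = col r (G x) by rewrite colE.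
pose X i k r := inner Om (fun x => col r (V x)) (fun x => U x *m col k (g i)).
pose Y i k r := inner Om (fun x => col r (V x)) (y i k).
have XY i k r (hi : (i < n)%N) :
    g i = id_col R m (Ordinal hi) -> X i k r = Y i k r.
  move=> gi; rewrite /X /Y -(colU (Ordinal hi)) gi col_id_col.
  by congr inner; apply/funext => x; rewrite colGP.
have step J k r (hJ : (J < n)%N) : g J = id_col R m (Ordinal hJ) ->
    X J.+1 k r + X `|(J%:Z - 1)%R|%N k r = Y J.+1 k r + Y `|(J%:Z - 1)%R|%N k r.
  move=> gJ; have := congr1 (fun Z : 'M[R]_(bsize n m, m * 2) => Z r k) (gal J).
  rewrite mxint_trmul [in RHS]mxE.
  rewrite (_ : (fun x => col k _) = fun x =>
    (U x *m col k (g J.+1) + U x *m col k (g `|(J%:Z - 1)%R|%N))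
    - 2 *: P (y J k) x); last first.
    apply/funext => x; rewrite -(colPU (Ordinal hJ)) -colGP gJ -col_id_col.
    by rewrite linearB linearZ /= !colE -!mulmxA mulmxDl mulmxDr.
  rewrite innerBr//; [|by apply: L2v_add => //; exact: L2v_mulmx|exact: L2v_scale].
  rewrite innerZr// innerDr//; [|exact: L2v_mulmx|exact: L2v_mulmx].
  by rewrite /Y rec// => /eqP; rewrite subr_eq0 => /eqP.
suff main J (hJ : (J < n)%N) : g J = id_col R m (Ordinal hJ).
  by move=> j; rewrite main; congr id_col; exact: val_inj.
elim/ltn_ind: J hJ => -[|J] IH hJ; first exact: (g0 (Ordinal hJ)).
have hJ' := ltnW hJ; have gJ := IH J (ltnSn J) hJ'.
have XYJ k r : X J.+1 k r = Y J.+1 k r.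
  have := step J k r hJ' gJ; case: J IH hJ hJ' gJ => [|J] IH hJ hJ' gJ.
    by rewrite /=; lra.
  have -> : `|(J.+1%:Z - 1)%R|%N = J by rewrite -addn1 PoszD addrK.
  have hJ2 := ltnW hJ'.
  by rewrite (XY J k r hJ2 (IH J (ltnW (ltnSn _)) hJ2)) => /addIr.
apply/matrixP => s k.
have : col k (g J.+1 - id_col R m (Ordinal hJ)) = 0.
  apply: gram_schmidt_inj => // r.
  rewrite (_ : (fun x => U x *m _) = fun x =>
    U x *m col k (g J.+1) - y J.+1 k x); last first.
    apply/funext => x; rewrite -(colU (Ordinal hJ)) -colGP -col_id_col.
    by rewrite -mulmxBr linearB.
  rewrite innerBr//; [|exact: L2v_mulmx|by rewrite -(colU (Ordinal hJ))].
  by apply/eqP; rewrite subr_eq0; apply/eqP; exact: XYJ.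
by move=> /matrixP /(_ s 0); rewrite !mxE => /eqP; rewrite subr_eq0 => /eqP.
Qed.

End GramSchmidt.
End Columns.

(** * Inner products of snapshots *)

Lemma cvgn_eq (R : realType) (A B : nat -> R) (l l' : R) :
  A @ \oo --> l -> B @ \oo --> l' -> A =1 B -> l = l'.
Proof.
move=> Al Bl' /funext AB; rewrite AB in Al.
by rewrite -(cvg_lim (@Rhausdorff R) Al); exact: (cvg_lim (@Rhausdorff R) Bl').
Qed.

Lemma cvgn_add (R : realType) (A B : nat -> R) (l l' : R) :
  A @ \oo --> l -> B @ \oo --> l' -> (fun N => A N + B N) @ \oo --> l + l'.
Proof. exact: cvgD. Qed.

Lemma cvgn_scale (R : realType) (k : R) (A : nat -> R) (l : R) :
  A @ \oo --> l -> (fun N => k * A N) @ \oo --> k * l.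
Proof. exact: cvgMr. Qed.

Section Snapshots.
Context (R : realType) (Om : set (plane R)) (mOm : measurable Om).
Variables (c : plane R -> 'M[R]_2) (theta : nat -> R) (phi : nat -> vfield R).
Hypothesis hphi : eigensystem Om c theta phi.
Variable cosA : R -> vfield R -> vfield R.
Hypothesis hcosA : forall t : R,
  spectral_op Om c theta phi (fun lam => cos (t * Num.sqrt lam)) (cosA t).
Variables (K : Type) (a : K -> nat -> R) (u0 : K -> vfield R).
Hypothesis hu0 : forall k, L2_sum Om (a k) phi (u0 k).
Variable D : R -> K -> K -> R.
Local Notation w q := (Num.sqrt (theta q)).
Hypothesis hD : forall t k l,
  (fun N => \sum_(q < N) a k q * a l q * cos (w q * t)) @ \oo --> D t k l.

Let Lphi := eigenfunction_L2v hphi.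
Let ortho := eigenfunction_ortho hphi.

Lemma data_norm t k l : D `|t| k l = D t k l.
Proof.
apply: (cvgn_eq (@hD `|t| k l) (@hD t k l)) => N; apply: eq_bigr => q _.
congr (_ * _); have [t0|t0] := lerP 0 t; first by rewrite ger0_norm.
by rewrite ltr0_norm// mulrN cosN.
Qed.

Lemma cosA_L2_sum b v t : L2_sum Om b phi v ->
  L2_sum Om (fun q => cos (t * w q) * b q) phi (cosA t v).
Proof.
move=> bv; have := hcosA t (L2_sum_rangeA mOm hphi bv).
rewrite (_ : (fun q => _) = fun q => cos (t * w q) * b q)//.
by apply/funext => q; rewrite (L2_sum_coef mOm Lphi ortho q bv).
Qed.

Lemma cosA_L2v t k : L2v Om (cosA t (u0 k)).
Proof. by have [] := cosA_L2_sum t (hu0 k). Qed.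

(** Parseval's identity and the product-to-sum formula for two cosines. *)
Lemma inner_cosA s t k l : inner Om (cosA s (u0 k)) (cosA t (u0 l)) =
  2^-1 * (D (s + t) k l + D (s - t) k l).
Proof.
have h1 := L2_sum_parseval mOm Lphi ortho
  (cosA_L2_sum s (hu0 k)) (cosA_L2_sum t (hu0 l)).
have h2 := cvgn_scale (k := 2^-1) (cvgn_add (@hD (s + t) k l) (@hD (s - t) k l)).
apply: (cvgn_eq h1 h2) => N /=.
rewrite -big_split mulr_sumr; apply: eq_bigr => q _ /=.
rewrite !(mulrC (w q)) mulrDl mulrBl cosD cosB; by field.
Qed.

Lemma inner_cosA_cosA s r t k l :
  inner Om (cosA s (u0 k)) (cosA r (cosA t (u0 l))) =
  4^-1 * (D (s + t + r) k l + D (s - t - r) k l + D (s + t - r) k l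
          + D (s - t + r) k l).
Proof.
have h1 := L2_sum_parseval mOm Lphi ortho
  (cosA_L2_sum s (hu0 k)) (cosA_L2_sum r (cosA_L2_sum t (hu0 l))).
have h2 := cvgn_scale (k := 4^-1) (cvgn_add (cvgn_add (cvgn_add (@hD (s + t + r) k l)
  (@hD (s - t - r) k l)) (@hD (s + t - r) k l)) (@hD (s - t + r) k l)).
apply: (cvgn_eq h1 h2) => N /=.
rewrite -!big_split mulr_sumr; apply: eq_bigr => q _ /=.
rewrite !(mulrC (w q)) !(mulrDl, mulNr) !(cosD, sinD, cosN, sinN); by field.
Qed.

(** Comparing coefficients in a weak form gives the three-term recursion without
    adding series.  The time t covers the absolute value in the first step, where
    s - r is negative. *)
Lemma cosA_recursion u s r t k : L2v Om u -> `|t| = `|s - r| ->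
  inner Om u (cosA (s + r) (u0 k)) + inner Om u (cosA t (u0 k)) =
  2 * inner Om u (cosA r (cosA s (u0 k))).
Proof.
move=> Lu tsr.
have h1 := cvgn_add (L2_sum_weak mOm Lphi Lu (cosA_L2_sum (s + r) (hu0 k)))
  (L2_sum_weak mOm Lphi Lu (cosA_L2_sum t (hu0 k))).
have h2 := cvgn_scale (k := 2)
  (L2_sum_weak mOm Lphi Lu (cosA_L2_sum r (cosA_L2_sum s (hu0 k)))).
apply: (cvgn_eq h1 h2) => N /=.
rewrite -!big_split mulr_sumr; apply: eq_bigr => q _ /=.
have -> : cos (t * w q) = cos ((s - r) * w q).
  by rewrite -[LHS]cos_norm -[RHS]cos_norm !normrM tsr.
rewrite mulrDl mulrBl cosD cosB; ring.
Qed.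

End Snapshots.

Unset Implicit Arguments.
Set Strict Implicit.
Set Printing Implicit Defensive.

Theorem theorem1 (R : realType)
  (Om : set (plane R)) (hOm : admissible_domain Om)
  (m : nat) (xs : 'I_m -> plane R) (F : 'I_m -> plane R -> R)
  (hF : antennas Om xs F)
  (Tf : R) (f : R -> R) (hf : pulse Tf f)
  (co : R) (hco : 0 < co)
  (c : plane R -> 'M[R]_2) (hc : piecewise_smooth_spd Om c)
  (hc0 : homogeneous_nearby Om co Tf xs c)
  (theta : nat -> R) (phi : nat -> vfield R)
  (hphi : eigensystem Om c theta phi)
  (FF : 'I_m -> 'I_2 -> vfield R)
  (hFF : forall s p, range_projection Om c (polarized (F s) p) (FF s p))
  (UU : 'I_m -> 'I_2 -> R -> vfield R)
  (hUU : forall s p, wave_solution Om c co Tf f (FF s p) (UU s p))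
  (u0 : 'I_m -> 'I_2 -> vfield R)
  (hu0 : forall s p, initial_state Om f theta phi (F s) p (u0 s p))
  (cosA : R -> vfield R -> vfield R)
  (hcosA : forall t : R,
     spectral_op Om c theta phi (fun lam => cos (t * Num.sqrt lam)) (cosA t))
  (tau : R) (htau : 0 < tau) (n : nat) (hn : (0 < n)%N)
  (hind : independent_columns Om (snapshots n cosA u0 tau))
  (V : plane R -> 'M[R]_(2, bsize n m)) (Rm : 'M[R]_(bsize n m))
  (hVR : block_gram_schmidt Om (snapshots n cosA u0 tau) V Rm)
  (g : nat -> 'M[R]_(bsize n m, m * 2))
  (hg : galerkin_coefficients Om (cosA tau) (snapshots n cosA u0 tau) V g) :
  let U : plane R -> 'M[R]_(2, bsize n m) := snapshots n cosA u0 tau in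
  let M := mass Om U in
  let S := stiffness Om (cosA tau) U in
  let t_ (k : int) : R := k%:~R * tau in
  let D := data Om co f F UU in
  [/\ forall j l : 'I_n,
        block M j l = 2^-1 *: (D (t_ (j%:Z + l%:Z)) + D (t_ `|j%:Z - l%:Z|)) /\
        block S j l = 4^-1 *: (D (t_ (j%:Z + l%:Z + 1))
                               + D (t_ `|j%:Z - l%:Z - 1|)
                               + D (t_ (j%:Z + l%:Z - 1))
                               + D (t_ `|j%:Z - l%:Z + 1|)),
      block_cholesky M Rm
    & forall j : 'I_n, g j = id_col R m j].
Proof.
have [oOm _ _ _ _] := hOm; have mOm := open_plane_measurable oOm.
have cT x : Om x -> (c x)^T = c x by have [_ cspd _] := hc; move=> /cspd[].
pose v k := polarized (F (exc k).1) (exc k).2.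
pose u k := u0 (exc k).1 (exc k).2.
pose a k q := abs_fhat f (Num.sqrt (theta q)) * inner Om (phi q) (v k).
have hu k : L2_sum Om (a k) phi (u k).
  have := hu0 (exc k).1 (exc k).2; rewrite /initial_state.
  rewrite (_ : (fun q => _) = a k)//; apply/funext => q.
  by rewrite /a innerC inner_polarized.
move=> U M S t_ D.
have hD t k l : (fun N => \sum_(q < N) a k q * a l q *
    cos (Num.sqrt (theta q) * t)) @ \oo --> D t k l.
  by apply: (data_series mOm cT hphi hco hf _ hFF hUU) => s; have [] := hF s.
(* from here on the data enter only through their series *)
clearbody D.
have colU j k : (fun x => col (block_index j k) (U x)) = cosA (j%:R * tau) (u k).
  apply/funext => x; rewrite -col_block_col /block_col mxrowK.
  by apply/matrixP => i z; rewrite ord1 !mxE.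
have LU r : L2v Om (fun x => col r (U x)).
  have [j [k ->]] := block_indexP r; rewrite colU.
  exact: (cosA_L2v mOm hphi hcosA hu).
have Dnorm z k l : D (t_ `|z|) k l = D (t_ z) k l.
  rewrite -(data_norm hD (t_ z)) /t_ normrM (ger0_norm (ltW htau)).
  by rewrite intr_norm.
have colPU j k : (fun x => col (block_index j k) (columnwise (cosA tau) U x)) =
    cosA tau (cosA (j%:R * tau) (u k)).
  apply/funext => x; apply/matrixP => i z; rewrite ord1 -colU !mxE.
  by [].
have addE (X Y : 'M[R]_(m * 2)) k i : (X + Y) k i = X k i + Y k i by rewrite mxE.
split.
- move=> j l; split; apply/matrixP => k i.
  + rewrite mxE /M /mass mxint_trmul !colU (inner_cosA mOm hphi hcosA hu hD).
    rewrite [RHS]mxE addE (Dnorm (j%:Z - l%:Z)) /t_ !rmorphB !rmorphD /=.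
    by rewrite mulrBl mulrDl.
  + rewrite mxE /S /stiffness mxint_trmul colU colPU.
    rewrite (inner_cosA_cosA mOm hphi hcosA hu hD).
    rewrite [RHS]mxE !addE (Dnorm (j%:Z - l%:Z - 1)) (Dnorm (j%:Z - l%:Z + 1)).
    rewrite /t_ !(rmorphB, rmorphD) /=.
    by rewrite !(mulrBl, mulrDl) mul1r.
- have [_ _ _ _ [up diag]] := hVR; split=> //.
  exact: (mass_cholesky mOm LU hVR).
- apply: (galerkin_id_col mOm LU hVR
    (y := fun i k => cosA (i%:R * tau) (u k)) colU _ _ hind hg) => [i k|w i k Lw].
    by have [] := cosA_L2_sum mOm hphi hcosA tau
      (cosA_L2_sum mOm hphi hcosA (i%:R * tau) (hu k)).
  rewrite -(cosA_recursion mOm hphi hcosA hu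
    (t := `|(i%:Z - 1)%R|%N%:R * tau) k Lw).
    by rewrite -natr1 mulrDl mul1r.
  rewrite natr_absz intr_norm normrM normr_id -normrM rmorphB /=.
  by rewrite mulrBl mul1r.
Qed.
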